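(* Under the hypotheses of Theorem 3.4 (real nonzero Banach spaces $X,Y$; $S:X\rightrightarrows X^*$, $T:Y\rightrightarrows Y^*$ maximal monotone of Gossez type (D) with strong representative functions $h_S,h_T$; $A:X\to Y$ linear continuous with $\big(\operatorname{dom}h_T\times\operatorname{pr}_{X^*}(\operatorname{dom}h_S)\big)\cap\big(\operatorname{im}A\times\Delta_{Y^*}^{A^*}\big)\neq\emptyset$), assume additionally $D(\overline S)\subseteq X$. Then, writing $E:=\operatorname{im}A\times\Delta_{Y^*}^{A^*}$, $${}^{ic}(G(T)\times R(S)-E)=\operatorname{ri}(G(T)\times R(S)-E)={}^{ic}(\operatorname{co}G(T)\times\operatorname{co}R(S)-E)=\operatorname{ri}(\operatorname{co}G(T)\times\operatorname{co}R(S)-E)={}^{ic}(\operatorname{dom}h_T\times\operatorname{pr}_{X^*}(\operatorname{dom}h_S)-E)=\operatorname{ri}(\operatorname{dom}h_T\times\operatorname{pr}_{X^*}(\operatorname{dom}h_S)-E).$$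
   Context: $G(M)$, $D(M)$, $R(M)$ graph, domain, range; $\operatorname{co}$ convex hull; $X$ identified with its image in $X^{**}$. Coupling $c(x,x^* )=\langle x^*,x\rangle$. Conjugate of $h$ on $X\times X^*$: $h^*(x^*,x^{**})=\sup_{(x,y^* )}\{\langle x^*,x\rangle+\langle x^{**},y^*\rangle-h(x,y^* )\}$. A representative function of monotone $S$: convex norm-lsc $h_S$ with $h_S\ge c$ and $G(S)\subseteq\{h_S=c\}$; strong if $h_S^*(x^*,x^{**})\ge\langle x^{**},x^*\rangle$ for all. Gossez's closure $\overline S:X^{**}\rightrightarrows X^*$ has graph $\{(x^{**},x^* ):\langle x^{**}-y,x^*-y^*\rangle\ge0\ \forall(y,y^* )\in G(S)\}$; maximal monotone $S$ is of Gossez type (D) if each point of $G(\overline S)$ is the $w^*\times\|\cdot\|_*$-limit of a bounded net in $G(S)$. $\operatorname{im}A=A(X)$; $\Delta_{Y^*}^{A^*}=\{(y^*,A^*y^* )\}$. $\operatorname{icr}D=\{u:\forall x\in\operatorname{aff}(D-D)\ \exists\delta>0\ \forall\lambda\in[0,\delta]:u+\lambda x\in D\}$; ${}^{ic}D=\operatorname{icr}D$ if $\operatorname{aff}D$ closed, else $\emptyset$; $\operatorname{ri}D$ = interior of $D$ relative to $\operatorname{aff}D$ if $\operatorname{aff}D$ closed, else $\emptyset$. *)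

(* Defs.v *)
From Stdlib Require Import Reals Lra List.
Open Scope R_scope.
Set Implicit Arguments.

Record Banach := {
  B :> Type;
  bzero : B;
  badd : B -> B -> B;
  bopp : B -> B;
  bscal : R -> B -> B;
  bnorm : B -> R;
  badd_assoc : forall x y z, badd x (badd y z) = badd (badd x y) z;
  badd_comm : forall x y, badd x y = badd y x;
  badd_0 : forall x, badd x bzero = x;
  badd_opp : forall x, badd x (bopp x) = bzero;
  bscal_1 : forall x, bscal 1 x = x;
  bscal_assoc : forall a b x, bscal a (bscal b x) = bscal (a * b) x;
  bscal_distr_v : forall a x y, bscal a (badd x y) = badd (bscal a x) (bscal a y);
  bscal_distr_s : forall a b x, bscal (a + b) x = badd (bscal a x) (bscal b x);
  bnorm_nonneg : forall x, 0 <= bnorm x;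
  bnorm_eq0 : forall x, bnorm x = 0 -> x = bzero;
  bnorm_scal : forall a x, bnorm (bscal a x) = Rabs a * bnorm x;
  bnorm_triang : forall x y, bnorm (badd x y) <= bnorm x + bnorm y;
  bcomplete : forall u : nat -> B,
    (forall eps, 0 < eps -> exists N, forall m n, (N <= m)%nat -> (N <= n)%nat ->
        bnorm (badd (u m) (bopp (u n))) < eps) ->
    exists l, forall eps, 0 < eps -> exists N, forall n, (N <= n)%nat ->
        bnorm (badd (u n) (bopp l)) < eps
}.

Definition bsub (X : Banach) (x y : X) : X := badd X x (bopp X y).
Arguments bsub {X} x y.
Definition nonzero_space (X : Banach) : Prop := exists x : X, x <> bzero X.

Definition is_dual (X : Banach) (f : X -> R) : Prop :=
  (forall x y, f (badd X x y) = f x + f y) /\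
  (forall c x, f (bscal X c x) = c * f x) /\
  (exists C, forall x, Rabs (f x) <= C * bnorm X x).

Definition Dual (X : Banach) := { f : X -> R | @is_dual X f }.

Definition pair (X : Banach) (f : Dual X) (x : X) : R := proj1_sig f x.

Definition dnorm_le (X : Banach) (f : Dual X) (M : R) : Prop :=
  forall x, Rabs (pair f x) <= M * bnorm X x.

Lemma dadd_ok (X : Banach) (f g : Dual X) : @is_dual X (fun x => pair f x + pair g x).
Proof.
  destruct f as [f [f1 [f2 [C1 f3]]]], g as [g [g1 [g2 [C2 g3]]]]; unfold pair; simpl.
  split; [|split].
  - intros; rewrite f1, g1; ring.
  - intros; rewrite f2, g2; ring.
  - exists (C1 + C2); intros x.
    eapply Rle_trans; [apply Rabs_triang|].
    specialize (f3 x); specialize (g3 x); rewrite Rmult_plus_distr_r; lra.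
Qed.

Lemma dscal_ok (X : Banach) (c : R) (f : Dual X) : @is_dual X (fun x => c * pair f x).
Proof.
  destruct f as [f [f1 [f2 [C f3]]]]; unfold pair; simpl.
  split; [|split].
  - intros; rewrite f1; ring.
  - intros; rewrite f2; ring.
  - exists (Rabs c * C); intros x. rewrite Rabs_mult, Rmult_assoc.
    apply Rmult_le_compat_l; [apply Rabs_pos| apply f3].
Qed.

Lemma dzero_ok (X : Banach) : @is_dual X (fun _ => 0).
Proof.
  split; [|split]; intros; try ring.
  exists 0; intros; rewrite Rabs_R0; lra.
Qed.

Definition dadd (X : Banach) (f g : Dual X) : Dual X := exist _ _ (dadd_ok f g).
Definition dscal (X : Banach) (c : R) (f : Dual X) : Dual X := exist _ _ (dscal_ok c f).
Definition dzero (X : Banach) : Dual X := exist _ _ (dzero_ok X).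
Definition dsub (X : Banach) (f g : Dual X) : Dual X := dadd f (dscal (-1) g).

Definition is_bidual (X : Banach) (phi : Dual X -> R) : Prop :=
  (forall f g, phi (dadd f g) = phi f + phi g) /\
  (forall c f, phi (dscal c f) = c * phi f) /\
  (exists C, forall f M, 0 <= M -> dnorm_le f M -> Rabs (phi f) <= C * M).

Definition Bidual (X : Banach) := { phi : Dual X -> R | @is_bidual X phi }.

Definition in_X (X : Banach) (phi : Bidual X) : Prop :=
  exists x : X, forall f : Dual X, proj1_sig phi f = pair f x.

Definition MOp (X : Banach) := X -> Dual X -> Prop.

Definition monotone (X : Banach) (S : MOp X) : Prop :=
  forall x xs y ys, S x xs -> S y ys -> 0 <= pair (dsub xs ys) (bsub x y).

Definition maximal_monotone (X : Banach) (S : MOp X) : Prop :=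
  monotone S /\
  forall x xs, (forall y ys, S y ys -> 0 <= pair (dsub xs ys) (bsub x y)) -> S x xs.

(** Gossez's closure: graph in X^** x X^* ; <x^** - y, x^* - y^*> *)
Definition gossez (X : Banach) (S : MOp X) (phi : Bidual X) (xs : Dual X) : Prop :=
  forall y ys, S y ys ->
    0 <= proj1_sig phi (dsub xs ys) - pair (dsub xs ys) y.

Definition directed (I : Type) (le : I -> I -> Prop) : Prop :=
  (exists i : I, True) /\
  (forall i, le i i) /\
  (forall i j k, le i j -> le j k -> le i k) /\
  (forall i j, exists k, le i k /\ le j k).

Definition gossez_type_D (X : Banach) (S : MOp X) : Prop :=
  forall (phi : Bidual X) (xs : Dual X), gossez S phi xs ->
    exists (I : Type) (le : I -> I -> Prop) (u : I -> X) (us : I -> Dual X),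
      directed le /\
      (forall i, S (u i) (us i)) /\
      (exists M, forall i, bnorm X (u i) <= M /\ dnorm_le (us i) M) /\
      (forall (f : Dual X) eps, 0 < eps -> exists i0, forall i, le i0 i ->
           Rabs (pair f (u i) - proj1_sig phi f) < eps) /\
      (forall eps, 0 < eps -> exists i0, forall i, le i0 i ->
           dnorm_le (dsub (us i) xs) eps).

Definition domain_of_gossez_in_X (X : Banach) (S : MOp X) : Prop :=
  forall phi xs, gossez S phi xs -> in_X phi.

Inductive ER := Fin : R -> ER | PInf : ER.

Definition ER_le (a : ER) (r : R) : Prop :=
  match a with Fin s => s <= r | PInf => False end.
Definition ER_ge (a : ER) (r : R) : Prop :=
  match a with Fin s => r <= s | PInf => True end.

Definition convex_fun (X : Banach) (h : X -> Dual X -> ER) : Prop :=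
  forall x1 f1 x2 f2 a1 a2 l, 0 <= l <= 1 ->
    ER_le (h x1 f1) a1 -> ER_le (h x2 f2) a2 ->
    ER_le (h (badd X (bscal X l x1) (bscal X (1 - l) x2))
             (dadd (dscal l f1) (dscal (1 - l) f2)))
          (l * a1 + (1 - l) * a2).

(** lower semicontinuity w.r.t. the norm topology of X x X^* (metrizable,
    so sequential): every sublevel set is closed *)
Definition norm_lsc (X : Banach) (h : X -> Dual X -> ER) : Prop :=
  forall (a : R) (u : nat -> X) (us : nat -> Dual X) x xs,
    (forall n, ER_le (h (u n) (us n)) a) ->
    (forall eps, 0 < eps -> exists N, forall n, (N <= n)%nat ->
        bnorm X (bsub (u n) x) <= eps /\ dnorm_le (dsub (us n) xs) eps) ->
    ER_le (h x xs) a.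

Definition dom (X : Banach) (h : X -> Dual X -> ER) (x : X) (xs : Dual X) : Prop :=
  exists r, h x xs = Fin r.

Definition representative (X : Banach) (S : MOp X) (h : X -> Dual X -> ER) : Prop :=
  convex_fun h /\ norm_lsc h /\
  (forall x xs, ER_ge (h x xs) (pair xs x)) /\
  (forall x xs, S x xs -> h x xs = Fin (pair xs x)).

(** strong: h^*(x^*, x^** ) >= <x^**, x^*>, where h^* is the sup over dom h *)
Definition strong_representative (X : Banach) (S : MOp X) (h : X -> Dual X -> ER) : Prop :=
  representative S h /\
  forall (xs : Dual X) (phi : Bidual X) eps, 0 < eps ->
    exists x ys r, h x ys = Fin r /\
      proj1_sig phi xs - eps < pair xs x + proj1_sig phi ys - r.

Definition lin_cont (X Y : Banach) (A : X -> Y) : Prop :=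
  (forall x y, A (badd X x y) = badd Y (A x) (A y)) /\
  (forall c x, A (bscal X c x) = bscal Y c (A x)) /\
  (exists C, forall x, bnorm Y (A x) <= C * bnorm X x).

Record VS := {
  V :> Type;
  vadd : V -> V -> V;
  vscal : R -> V -> V;
  vzero : V;
  vsmall : V -> R -> Prop  (* vsmall v r  <->  ||v|| <= r *)
}.

Definition vsub (W : VS) (u v : W) : W := vadd W u (vscal W (-1) v).

Definition lincomb (W : VS) (l : list (R * W)) : W :=
  fold_right (fun p acc => vadd W (vscal W (fst p) (snd p)) acc) (vzero W) l.
Arguments lincomb {W}.
Arguments vsub {W}.

Definition sum_coef (W : VS) (l : list (R * W)) : R :=
  fold_right (fun p acc => fst p + acc) 0 l.
Arguments sum_coef {W}.

Definition aff (W : VS) (D : W -> Prop) : W -> Prop :=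
  fun z => exists l : list (R * W),
    Forall (fun p => D (snd p)) l /\ sum_coef l = 1 /\ z = lincomb l.
Arguments aff {W}.

Definition co (W : VS) (D : W -> Prop) : W -> Prop :=
  fun z => exists l : list (R * W),
    Forall (fun p => D (snd p) /\ 0 <= fst p) l /\ sum_coef l = 1 /\ z = lincomb l.
Arguments co {W}.

Definition diffset (W : VS) (D : W -> Prop) : W -> Prop :=
  fun z => exists a b, D a /\ D b /\ z = vsub a b.
Arguments diffset {W}.

Definition closed_set (W : VS) (C : W -> Prop) : Prop :=
  forall (z : nat -> W) (l : W), (forall n, C (z n)) ->
    (forall eps, 0 < eps -> exists N, forall n, (N <= n)%nat -> vsmall W (vsub (z n) l) eps) ->
    C l.
Arguments closed_set {W}.

Definition icr (W : VS) (D : W -> Prop) : W -> Prop :=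
  fun u => forall x, aff (diffset D) x ->
    exists delta, 0 < delta /\ forall lam, 0 <= lam <= delta -> D (vadd W u (vscal W lam x)).
Arguments icr {W}.

Definition ic (W : VS) (D : W -> Prop) : W -> Prop :=
  fun u => closed_set (aff D) /\ icr D u.
Arguments ic {W}.

Definition ri (W : VS) (D : W -> Prop) : W -> Prop :=
  fun u => closed_set (aff D) /\ D u /\
    exists delta, 0 < delta /\ forall v, aff D v -> vsmall W (vsub v u) delta -> D v.
Arguments ri {W}.

Definition set_eq (W : Type) (P Q : W -> Prop) : Prop := forall z, P z <-> Q z.

Definition VS_B (X : Banach) : VS :=
  {| V := B X; vadd := badd X; vscal := bscal X; vzero := bzero X;
     vsmall := fun x r => bnorm X x <= r |}.

Definition VS_D (X : Banach) : VS :=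
  {| V := Dual X; vadd := @dadd X; vscal := @dscal X; vzero := dzero X;
     vsmall := @dnorm_le X |}.

Definition VS_prod (W1 W2 : VS) : VS :=
  {| V := (V W1 * V W2)%type;
     vadd := fun p q => (vadd W1 (fst p) (fst q), vadd W2 (snd p) (snd q));
     vscal := fun c p => (vscal W1 c (fst p), vscal W2 c (snd p));
     vzero := (vzero W1, vzero W2);
     vsmall := fun p r => vsmall W1 (fst p) r /\ vsmall W2 (snd p) r |}.

Definition VS_T (X Y : Banach) : VS := VS_prod (VS_prod (VS_B Y) (VS_D Y)) (VS_D X).

Definition set_minus (W : VS) (D Ec : W -> Prop) : W -> Prop :=
  fun z => exists d e, D d /\ Ec e /\ z = vsub d e.
Arguments set_minus {W}.

(** E = im A x Delta_{Y^*}^{A^*} ;  (y^*, x^* ) in Delta iff x^* = A^* y^* *)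
Definition E_set (X Y : Banach) (A : X -> Y) : VS_T X Y -> Prop :=
  fun z => let '((y, ys), xs) := z in
    (exists x, y = A x) /\ (forall x, pair xs x = pair ys (A x)).

Definition GT_RS (X Y : Banach) (S : MOp X) (T : MOp Y) : VS_T X Y -> Prop :=
  fun z => let '((y, ys), xs) := z in T y ys /\ exists x, S x xs.

Definition coGT_coRS (X Y : Banach) (S : MOp X) (T : MOp Y) : VS_T X Y -> Prop :=
  fun z => let '((y, ys), xs) := z in
    co (W := VS_prod (VS_B Y) (VS_D Y)) (fun p => T (fst p) (snd p)) (y, ys) /\
    co (W := VS_D X) (fun f => exists x, S x f) xs.

Definition domT_prS (X Y : Banach) (hS : X -> Dual X -> ER) (hT : Y -> Dual Y -> ER)
  : VS_T X Y -> Prop :=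
  fun z => let '((y, ys), xs) := z in dom hT y ys /\ exists x, dom hS x xs.

Arguments lin_cont {X Y} A.
Arguments E_set {X Y} A _.
Arguments GT_RS {X Y} S T _.
Arguments coGT_coRS {X Y} S T _.
Arguments domT_prS {X Y} hS hT _.

(* Main.v *)
Require Import Defs.
From Stdlib Require Import Reals Lra Lia List.
From Stdlib Require Import ClassicalEpsilon FunctionalExtensionality ProofIrrelevance.
From mathcomp Require boolp classical_sets.
Open Scope R_scope.
Set Bullet Behavior "Strict Subproofs".

(** Write [K1 <= K2 <= K3] for the three difference sets. A relative interior is always contained in
    the intrinsic core, so it suffices to prove three facts.

    (i) [ic K3 <= ri K3]: an element of [K3] is the image of a point of an effective domain under a
    continuous linear map (the residual), so Baire's theorem and convex series apply.

    (ii) [ic K3 <= K1]: after a translation the point is 0, and one must solve [A* w in S a],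
    [w in T (A z)]. By (i), exact Fenchel duality holds for the inf-convolution
    [h (x, A* w) = inf { hS (u, A* w) + hT (A (x - u), w) }]. Since [hS] and [hT] are strong, every
    quadratically penalised problem has infimum at most 0, and iterating almost-minimisers gives a
    limit point at which the conjugate of [h] is at most the coupling. The dual solution there is a
    pair in the graphs of the Gossez closures; its component in [X**] lies in [X] because
    [D(S-bar)] does, which puts the other component in [Y].

    (iii) If [K1 <= D <= K3] and [aff D] is closed, then [K3 <= aff D]: a continuous functional
    constant on [K1] is an isotropic direction for the coupling, so the Gossez closure of the
    operator is invariant under translations along it, and this forces the functional to take the
    same constant value on the domain of any representative function. *)

(** * Vector identities *)

(** Without reflexivity, minimisers and norming vectors need not exist and dual solutions live in
    biduals. Every extremal problem is therefore solved up to an error, and completeness replaces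
    compactness: an almost-minimiser with error [e^2] admits a better one at distance of order [e],
    so halving [e] yields a Cauchy sequence. The inf-convolution need not be lower semicontinuous,
    so nothing is claimed about its value at the limit point; a bound on its conjugate, which is
    tested at one fixed point at a time, does survive the limit. Projections of closed sets need not
    be closed either. This is why the residual starts from six coordinates: upstairs, where the
    parameters of [E] and the point of [X] are kept, the sublevel sets are closed and convex, and
    only their images enter Baire's theorem. The ambient space there is the closed direction space
    of the affine hull, since that hull may be proper. Strongness carries (ii) and type (D) carries
    (iii). *)

Section VectorIdentities.
Variable X : Banach.

Inductive vexpr :=
| VAtom : nat -> vexpr
| VZero : vexpr
| VAdd : vexpr -> vexpr -> vexpr
| VOpp : vexpr -> vexpr
| VScal : R -> vexpr -> vexpr.

Fixpoint veval (l : list X) (e : vexpr) : X :=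
  match e with
  | VAtom n => nth n l (bzero X)
  | VZero => bzero X
  | VAdd a b => badd X (veval l a) (veval l b)
  | VOpp a => bopp X (veval l a)
  | VScal c a => bscal X c (veval l a)
  end.

Fixpoint vcoef (e : vexpr) (n : nat) : R :=
  match e with
  | VAtom m => if Nat.eqb m n then 1 else 0
  | VZero => 0
  | VAdd a b => vcoef a n + vcoef b n
  | VOpp a => - vcoef a n
  | VScal c a => c * vcoef a n
  end.

Fixpoint combination (l : list X) (c : nat -> R) : X :=
  match l with
  | nil => bzero X
  | x :: l' => badd X (bscal X (c O) x) (combination l' (fun n => c (S n)))
  end.

(** A recursion on the number of atoms instead of a quantifier over indices, so that [cbn] leaves
    finitely many real equations for [ring]. *)
Fixpoint same_coefs (k : nat) (c d : nat -> R) : Prop :=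
  match k with
  | O => True
  | S k' => c O = d O /\ same_coefs k' (fun n => c (S n)) (fun n => d (S n))
  end.

Lemma badd_0l (x : X) : badd X (bzero X) x = x.
Proof. rewrite badd_comm. apply badd_0. Qed.

Lemma badd_cancel (x y z : X) : badd X x y = badd X x z -> y = z.
Proof.
  intros H.
  rewrite <- (badd_0l y), <- (badd_0l z), <- (badd_opp X x), (badd_comm X x).
  rewrite <- !badd_assoc. now rewrite H.
Qed.

Lemma bscal_0l (x : X) : bscal X 0 x = bzero X.
Proof.
  apply (@badd_cancel (bscal X 0 x)). rewrite <- bscal_distr_s, badd_0. f_equal; ring.
Qed.

Lemma bscal_0r (c : R) : bscal X c (bzero X) = bzero X.
Proof.
  apply (@badd_cancel (bscal X c (bzero X))). rewrite <- bscal_distr_v, !badd_0. reflexivity.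
Qed.

Lemma bopp_scal (x : X) : bopp X x = bscal X (-1) x.
Proof.
  apply (@badd_cancel x). rewrite badd_opp.
  rewrite <- (bscal_1 X x) at 1. rewrite <- bscal_distr_s.
  replace (1 + -1) with 0 by ring. now rewrite bscal_0l.
Qed.

Lemma badd_swap (a b c d : X) :
  badd X (badd X a b) (badd X c d) = badd X (badd X a c) (badd X b d).
Proof.
  rewrite <- !badd_assoc. f_equal. rewrite !badd_assoc. f_equal. apply badd_comm.
Qed.

Lemma combination_ext (l : list X) : forall c d,
  same_coefs (length l) c d -> combination l c = combination l d.
Proof.
  induction l as [|x l IH]; intros c d; simpl; [reflexivity|].
  intros [H1 H2]. rewrite H1, (IH _ _ H2). reflexivity.
Qed.

Lemma combination_0 (l : list X) : combination l (fun _ => 0) = bzero X.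
Proof. induction l; simpl; [reflexivity|]. rewrite IHl, bscal_0l. apply badd_0. Qed.

Lemma combination_add (l : list X) : forall c d,
  combination l (fun n => c n + d n) = badd X (combination l c) (combination l d).
Proof.
  induction l as [|x l IH]; intros c d; simpl; [now rewrite badd_0|].
  rewrite (IH (fun n => c (S n)) (fun n => d (S n))), bscal_distr_s. apply badd_swap.
Qed.

Lemma combination_scal (l : list X) a : forall c,
  combination l (fun n => a * c n) = bscal X a (combination l c).
Proof.
  induction l as [|x l IH]; intros c; simpl; [now rewrite bscal_0r|].
  rewrite (IH (fun n => c (S n))), bscal_distr_v, bscal_assoc. reflexivity.
Qed.

Lemma combination_atom (l : list X) : forall m,
  combination l (fun n => if Nat.eqb m n then 1 else 0) = nth m l (bzero X).
Proof.
  induction l as [|x l IH]; intros [|m]; simpl; try reflexivity.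
  - rewrite combination_0, bscal_1. apply badd_0.
  - rewrite IH, bscal_0l. apply badd_0l.
Qed.

Lemma veval_combination (l : list X) (e : vexpr) : veval l e = combination l (vcoef e).
Proof.
  induction e; simpl.
  - symmetry; apply combination_atom.
  - symmetry; apply combination_0.
  - rewrite IHe1, IHe2. symmetry. apply combination_add.
  - rewrite IHe, bopp_scal, <- combination_scal. f_equal.
    apply functional_extensionality; intros; ring.
  - rewrite IHe. symmetry. apply combination_scal.
Qed.

Lemma veval_eq (l : list X) (e1 e2 : vexpr) :
  same_coefs (length l) (vcoef e1) (vcoef e2) -> veval l e1 = veval l e2.
Proof. intros H. rewrite !veval_combination. now apply combination_ext. Qed.

End VectorIdentities.

Ltac vec_index a l :=
  lazymatch l with
  | cons a _ => constr:(O)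
  | cons _ ?l' => let n := vec_index a l' in constr:(S n)
  end.
Ltac vec_insert a l :=
  let rec mem l0 := lazymatch l0 with
    | nil => constr:(false) | cons a _ => constr:(true) | cons _ ?l' => mem l' end in
  let b := mem l in
  lazymatch b with true => l | false => constr:(cons a l) end.
Ltac vec_atoms l e :=
  lazymatch e with
  | bzero _ => l
  | badd _ ?a ?b => let l1 := vec_atoms l a in vec_atoms l1 b
  | bopp _ ?a => vec_atoms l a
  | bscal _ _ ?a => vec_atoms l a
  | _ => vec_insert e l
  end.
Ltac vec_reify l e :=
  lazymatch e with
  | bzero _ => constr:(VZero)
  | badd _ ?a ?b =>
      let x := vec_reify l a in let y := vec_reify l b in constr:(VAdd x y)
  | bopp _ ?a => let x := vec_reify l a in constr:(VOpp x)
  | bscal _ ?c ?a => let x := vec_reify l a in constr:(VScal c x)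
  | _ => let n := vec_index e l in constr:(VAtom n)
  end.
Ltac vec_reduce :=
  unfold bsub, vsub in *;
  cbn [V vadd vscal vzero VS_B] in *;
  lazymatch goal with
  | |- @eq _ ?a ?b =>
      let T := lazymatch type of a with B ?X => X | V (VS_B ?X) => X end in
      let l0 := vec_atoms (@nil (B T)) a in
      let l := vec_atoms l0 b in
      let ea := vec_reify l a in let eb := vec_reify l b in
      change (veval T l ea = veval T l eb);
      apply veval_eq; cbn [same_coefs length vcoef Nat.eqb]; repeat split
  end.
(** Decides equalities of linear expressions by comparing coefficients of the atoms. *)
Ltac vec := vec_reduce; try ring; try (field; lra).

(** * Norm estimates and geometric sequences *)

Section Norm.
Variable X : Banach.
Implicit Types x y z : X.

Lemma bnorm_zero : bnorm X (bzero X) = 0.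
Proof. rewrite <- (bscal_0l X (bzero X)), bnorm_scal, Rabs_R0. ring. Qed.

Lemma bnorm_opp x : bnorm X (bopp X x) = bnorm X x.
Proof. rewrite bopp_scal, bnorm_scal, Rabs_left; lra. Qed.

Lemma bnorm_sub_comm x y : bnorm X (bsub x y) = bnorm X (bsub y x).
Proof. rewrite <- bnorm_opp. f_equal. vec. Qed.

Lemma bnorm_sub_triang x y z : bnorm X (bsub x z) <= bnorm X (bsub x y) + bnorm X (bsub y z).
Proof.
  replace (bsub x z) with (badd X (bsub x y) (bsub y z)) by vec. apply bnorm_triang.
Qed.

Lemma bnorm_sub_le x y : bnorm X (bsub x y) <= bnorm X x + bnorm X y.
Proof. unfold bsub. rewrite <- (bnorm_opp y). apply bnorm_triang. Qed.

Lemma bnorm_le_sub x y : bnorm X x <= bnorm X (bsub x y) + bnorm X y.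
Proof. replace x with (badd X (bsub x y) y) at 1 by vec. apply bnorm_triang. Qed.

Lemma bnorm_scal_pos c x : 0 <= c -> bnorm X (bscal X c x) = c * bnorm X x.
Proof. intros H. rewrite bnorm_scal, Rabs_right; lra. Qed.

Lemma bsub_eq0 x y : bnorm X (bsub x y) = 0 -> x = y.
Proof.
  intros H. apply bnorm_eq0 in H. replace x with (badd X (bsub x y) y) by vec.
  rewrite H. vec.
Qed.

Definition converges (u : nat -> X) (l : X) :=
  forall eps, 0 < eps -> exists N, forall n, (N <= n)%nat -> bnorm X (bsub (u n) l) <= eps.

Lemma pow_half_pos n : 0 < (/2)^n.
Proof. apply pow_lt; lra. Qed.

Lemma pow_half_small eps : 0 < eps -> exists N, forall n, (N <= n)%nat -> (/2)^n <= eps.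
Proof.
  intros He. destruct (@pow_lt_1_zero (/2)) with (y := eps) as [N HN]; [|assumption|].
  - rewrite Rabs_right; lra.
  - exists N. intros n Hn. specialize (HN n Hn).
    rewrite Rabs_right in HN; [lra|]. pose proof (pow_half_pos n); lra.
Qed.

Lemma geometric_converges (u : nat -> X) K :
  (forall n, bnorm X (bsub (u (S n)) (u n)) <= K * (/2)^n) ->
  exists l, converges u l /\ forall n, bnorm X (bsub (u n) l) <= 2 * K * (/2)^n.
Proof.
  intros H.
  assert (HK : 0 <= K).
  { specialize (H O). cbn [pow] in H. pose proof (bnorm_nonneg X (bsub (u 1%nat) (u O))). lra. }
  (* The factor [1 - (/2)^k] is the exact partial geometric sum; with the cruder bound
     [2 * K * (/2)^n] the induction on [k] would not close. *)
  assert (Hd : forall n k, bnorm X (bsub (u (k + n)%nat) (u n)) <= 2 * K * (/2)^n * (1 - (/2)^k)).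
  { intros n; induction k as [|k IH]; cbn [pow Nat.add].
    - replace (bsub (u n) (u n)) with (bzero X) by vec. rewrite bnorm_zero. lra.
    - eapply Rle_trans; [apply bnorm_sub_triang with (y := u (k + n)%nat)|].
      specialize (H (k + n)%nat). rewrite pow_add in H. lra. }
  assert (Hd' : forall m n, (n <= m)%nat -> bnorm X (bsub (u m) (u n)) <= 2 * K * (/2)^n).
  { intros m n Hmn. replace m with ((m - n) + n)%nat by lia.
    eapply Rle_trans; [apply Hd|]. pose proof (pow_half_pos (m - n)).
    pose proof (pow_half_pos n).
    assert (0 <= K * (/2)^n * (/2)^(m - n)) by (repeat apply Rmult_le_pos; lra). lra. }
  assert (Hsm : forall eps, 0 < eps -> exists N, forall n, (N <= n)%nat -> 2 * K * (/2)^n <= eps).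
  { intros eps He. destruct (@pow_half_small (eps / (2 * K + 1))) as [N HN].
    { apply Rdiv_lt_0_compat; lra. }
    exists N. intros n Hn. specialize (HN n Hn).
    apply Rle_trans with ((2 * K + 1) * (eps / (2 * K + 1))).
    - pose proof (pow_half_pos n). nra.
    - right. field. lra. }
  destruct (bcomplete X u) as [l Hl].
  { intros eps He. destruct (Hsm (eps / 2)) as [N HN]; [lra|].
    exists N. intros m n Hm Hn. specialize (HN N (le_n N)).
    change (bnorm X (bsub (u m) (u n)) < eps).
    destruct (Nat.le_gt_cases n m) as [Hc|Hc].
    - pose proof (Hd' m n Hc). pose proof (Hd' n N Hn). pose proof (Hd' m N Hm).
      destruct (Hsm (eps/2)) as [N' _]; [lra|].
      assert ((/2)^n <= (/2)^N).
      { replace n with ((n-N)+N)%nat by lia. rewrite pow_add.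
        assert ((/2)^(n-N) <= 1) by (rewrite <- (pow1 (n-N)); apply pow_incr; lra).
        pose proof (pow_half_pos N). nra. }
      assert (2 * K * (/2)^n <= 2 * K * (/2)^N) by nra. lra.
    - rewrite bnorm_sub_comm.
      pose proof (Hd' n m ltac:(lia)).
      assert ((/2)^m <= (/2)^N).
      { replace m with ((m-N)+N)%nat by lia. rewrite pow_add.
        assert ((/2)^(m-N) <= 1) by (rewrite <- (pow1 (m-N)); apply pow_incr; lra).
        pose proof (pow_half_pos N). nra. }
      assert (2 * K * (/2)^m <= 2 * K * (/2)^N) by nra. lra. }
  assert (Hc : converges u l).
  { intros eps He. destruct (Hl eps He) as [N HN]. exists N. intros n Hn.
    left. apply (HN n Hn). }
  exists l. split; [assumption|].
  intros n. apply le_epsilon. intros eps He.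
  destruct (Hc eps He) as [N HN].
  eapply Rle_trans; [apply bnorm_sub_triang with (y := u (n + N)%nat)|].
  pose proof (HN (n + N)%nat ltac:(lia)). rewrite bnorm_sub_comm.
  pose proof (Hd' (n + N)%nat n ltac:(lia)). lra.
Qed.

End Norm.
Arguments converges {X} u l.

(** * Dual and product spaces *)

Section DualSpace.
Variable X : Banach.
Implicit Types (f g : Dual X) (x y : X).

Lemma dual_ext f g : (forall x, pair f x = pair g x) -> f = g.
Proof.
  destruct f as [f Hf], g as [g Hg]; unfold pair; simpl. intros H.
  assert (f = g) by now apply functional_extensionality. subst g.
  f_equal. apply proof_irrelevance.
Qed.

Lemma pair_add f g x : pair (dadd f g) x = pair f x + pair g x.
Proof. reflexivity. Qed.
Lemma pair_scal c f x : pair (dscal c f) x = c * pair f x.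
Proof. reflexivity. Qed.
Lemma pair_zero x : pair (dzero X) x = 0.
Proof. reflexivity. Qed.
Lemma pair_sub f g x : pair (dsub f g) x = pair f x - pair g x.
Proof. unfold dsub. rewrite pair_add, pair_scal. ring. Qed.
Lemma pair_addr f x y : pair f (badd X x y) = pair f x + pair f y.
Proof. apply (proj2_sig f). Qed.
Lemma pair_scalr f c x : pair f (bscal X c x) = c * pair f x.
Proof. apply (proj2_sig f). Qed.
Lemma pair_oppr f x : pair f (bopp X x) = - pair f x.
Proof. rewrite bopp_scal, pair_scalr. ring. Qed.
Lemma pair_subr f x y : pair f (bsub x y) = pair f x - pair f y.
Proof. unfold bsub. rewrite pair_addr, pair_oppr. ring. Qed.
Lemma pair_zeror f : pair f (bzero X) = 0.
Proof. rewrite <- (bscal_0l X (bzero X)), pair_scalr. ring. Qed.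

Lemma dual_bounded f : exists C, 0 <= C /\ dnorm_le f C.
Proof.
  destruct (proj2_sig f) as [_ [_ [C H]]]. exists (Rabs C). split; [apply Rabs_pos|].
  intros x. eapply Rle_trans; [apply H|]. apply Rmult_le_compat_r; [apply bnorm_nonneg|].
  apply RRle_abs.
Qed.

(** A sigma type, so that [dnorm] can be a function; [completeness] delivers its supremum in this
    form. Minimality is asked among nonnegative bounds only, because on the zero space every real
    [M] satisfies [dnorm_le f M]. *)
Lemma dnorm_exists f :
  { m | 0 <= m /\ dnorm_le f m /\ forall M, 0 <= M -> dnorm_le f M -> m <= M }.
Proof.
  destruct (completeness (fun r => exists x, bnorm X x <= 1 /\ r = Rabs (pair f x))) as [m [Hm1 Hm2]].
  - destruct (dual_bounded f) as [C [HC H]]. exists C. intros r [x [Hx ->]].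
    eapply Rle_trans; [apply H|]. pose proof (bnorm_nonneg X x). nra.
  - exists 0, (bzero X). rewrite bnorm_zero, pair_zeror, Rabs_R0. split; lra.
  - exists m. split; [|split].
    + apply Hm1. exists (bzero X). rewrite bnorm_zero, pair_zeror, Rabs_R0. split; lra.
    + intros x. destruct (Req_dec (bnorm X x) 0) as [H0|H0].
      * apply bnorm_eq0 in H0. subst x. rewrite pair_zeror, bnorm_zero, Rabs_R0. lra.
      * pose proof (bnorm_nonneg X x).
        assert (H1 : Rabs (pair f (bscal X (/ bnorm X x) x)) <= m).
        { apply Hm1. exists (bscal X (/ bnorm X x) x). split; [|reflexivity].
          rewrite bnorm_scal_pos by (left; apply Rinv_0_lt_compat; lra).
          right. field. assumption. }
        rewrite pair_scalr, Rabs_mult, (Rabs_right (/ bnorm X x)) in H1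
          by (left; apply Rinv_0_lt_compat; lra).
        apply Rmult_le_reg_l with (/ bnorm X x); [apply Rinv_0_lt_compat; lra|].
        eapply Rle_trans; [apply H1|]. right. field. assumption.
    + intros M HM H. apply Hm2. intros r [x [Hx ->]].
      eapply Rle_trans; [apply H|]. pose proof (bnorm_nonneg X x). nra.
Qed.

Definition dnorm f : R := proj1_sig (dnorm_exists f).

Lemma dnorm_nonneg f : 0 <= dnorm f.
Proof. apply (proj2_sig (dnorm_exists f)). Qed.
Lemma dnorm_bound f : dnorm_le f (dnorm f).
Proof. apply (proj2_sig (dnorm_exists f)). Qed.
Lemma dnorm_least f M : 0 <= M -> dnorm_le f M -> dnorm f <= M.
Proof. apply (proj2_sig (dnorm_exists f)). Qed.
Lemma dnorm_le_mono f M M' : M <= M' -> dnorm_le f M -> dnorm_le f M'.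
Proof.
  intros HM H x. eapply Rle_trans; [apply H|].
  apply Rmult_le_compat_r; [apply bnorm_nonneg|assumption].
Qed.
Lemma dnorm_le_iff f M : 0 <= M -> (dnorm_le f M <-> dnorm f <= M).
Proof.
  intros HM. split; [now apply dnorm_least|].
  intros H. apply dnorm_le_mono with (dnorm f); [assumption|apply dnorm_bound].
Qed.

Lemma dnorm_eq0 f : dnorm f = 0 -> f = dzero X.
Proof.
  intros H. apply dual_ext. intros x. rewrite pair_zero.
  pose proof (dnorm_bound f x) as Hx. rewrite H, Rmult_0_l in Hx.
  pose proof (Rabs_pos (pair f x)). destruct (Req_dec (pair f x) 0) as [|Hn]; [assumption|].
  apply Rabs_pos_lt in Hn. lra.
Qed.

Lemma dnorm_scal_le c f : dnorm (dscal c f) <= Rabs c * dnorm f.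
Proof.
  apply dnorm_least.
  - apply Rmult_le_pos; [apply Rabs_pos|apply dnorm_nonneg].
  - intros x. rewrite pair_scal, Rabs_mult, Rmult_assoc.
    apply Rmult_le_compat_l; [apply Rabs_pos|apply dnorm_bound].
Qed.

Lemma dnorm_scal c f : dnorm (dscal c f) = Rabs c * dnorm f.
Proof.
  apply Rle_antisym; [apply dnorm_scal_le|].
  destruct (Req_dec c 0) as [->|Hc].
  - rewrite Rabs_R0, Rmult_0_l. apply dnorm_nonneg.
  - pose proof (dnorm_scal_le (/ c) (dscal c f)) as H.
    replace (dscal (/ c) (dscal c f)) with f in H
      by (apply dual_ext; intros; rewrite !pair_scal; field; assumption).
    apply Rmult_le_compat_l with (r := Rabs c) in H; [|apply Rabs_pos].
    eapply Rle_trans; [apply H|]. right.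
    rewrite <- Rmult_assoc, <- Rabs_mult, Rinv_r, Rabs_R1 by assumption. ring.
Qed.

Lemma dnorm_triang f g : dnorm (dadd f g) <= dnorm f + dnorm g.
Proof.
  pose proof (dnorm_nonneg f). pose proof (dnorm_nonneg g).
  apply dnorm_least; [lra|]. intros x. rewrite pair_add.
  eapply Rle_trans; [apply Rabs_triang|].
  pose proof (dnorm_bound f x). pose proof (dnorm_bound g x). lra.
Qed.

(** Limits exist pointwise; passing the Cauchy estimate to the limit at each [x], with an [eps]
    independent of [x], gives both boundedness of the limit functional and convergence in norm. *)
Lemma dual_complete (u : nat -> Dual X) :
  (forall eps, 0 < eps -> exists N, forall m n, (N <= m)%nat -> (N <= n)%nat ->
      dnorm (dadd (u m) (dscal (-1) (u n))) < eps) ->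
  exists l, forall eps, 0 < eps -> exists N, forall n, (N <= n)%nat ->
      dnorm (dadd (u n) (dscal (-1) l)) < eps.
Proof.
  intros H.
  assert (Hb : forall m n x, Rabs (pair (u m) x - pair (u n) x)
            <= dnorm (dadd (u m) (dscal (-1) (u n))) * bnorm X x).
  { intros m n x. pose proof (dnorm_bound (dadd (u m) (dscal (-1) (u n))) x) as Hx.
    rewrite pair_add, pair_scal in Hx.
    replace (pair (u m) x - pair (u n) x) with (pair (u m) x + -1 * pair (u n) x) by ring.
    assumption. }
  assert (Hl : forall x, { l | Un_cv (fun n => pair (u n) x) l }).
  { intros x. apply R_complete. intros eps He.
    pose proof (bnorm_nonneg X x).
    destruct (H (eps / (bnorm X x + 1))) as [N HN]; [apply Rdiv_lt_0_compat; lra|].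
    exists N. intros n m Hn Hm. unfold Rdist.
    eapply Rle_lt_trans; [apply Hb|]. specialize (HN n m Hn Hm).
    apply Rle_lt_trans with (eps / (bnorm X x + 1) * bnorm X x);
      [apply Rmult_le_compat_r; lra|].
    apply Rlt_le_trans with (eps / (bnorm X x + 1) * (bnorm X x + 1)).
    - apply Rmult_lt_compat_l; [apply Rdiv_lt_0_compat; lra|lra].
    - right. field. lra. }
  set (l := fun x => proj1_sig (Hl x)).
  assert (Hc : forall x, Un_cv (fun n => pair (u n) x) (l x))
    by (intros x; apply (proj2_sig (Hl x))).
  assert (Hlim : forall eps N, (forall m n, (N <= m)%nat -> (N <= n)%nat ->
      dnorm (dadd (u m) (dscal (-1) (u n))) < eps) ->
      forall n x, (N <= n)%nat -> Rabs (pair (u n) x - l x) <= eps * bnorm X x).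
  { intros eps N HN n x Hn. apply le_epsilon. intros e He.
    destruct (Hc x e He) as [N' HN'].
    specialize (HN' (N + N')%nat ltac:(lia)). unfold Rdist in HN'.
    replace (pair (u n) x - l x) with
      ((pair (u n) x - pair (u (N + N')%nat) x) + (pair (u (N + N')%nat) x - l x)) by ring.
    eapply Rle_trans; [apply Rabs_triang|].
    pose proof (Hb n (N + N')%nat x). specialize (HN n (N + N')%nat Hn ltac:(lia)).
    pose proof (bnorm_nonneg X x).
    assert (dnorm (dadd (u n) (dscal (-1) (u (N + N')%nat))) * bnorm X x <= eps * bnorm X x)
      by (apply Rmult_le_compat_r; lra).
    lra. }
  assert (Hdual : is_dual X l).
  { split; [|split].
    - intros x y. apply (UL_sequence (fun n => pair (u n) (badd X x y))); [apply Hc|].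
      replace (fun n => pair (u n) (badd X x y)) with (fun n => pair (u n) x + pair (u n) y)
        by (apply functional_extensionality; intros; now rewrite pair_addr).
      apply CV_plus; apply Hc.
    - intros c x. apply (UL_sequence (fun n => pair (u n) (bscal X c x))); [apply Hc|].
      replace (fun n => pair (u n) (bscal X c x)) with (fun n => c * pair (u n) x)
        by (apply functional_extensionality; intros; now rewrite pair_scalr).
      apply CV_mult; [|apply Hc].
      intros e He. exists O. intros. unfold Rdist. rewrite Rminus_diag, Rabs_R0. assumption.
    - destruct (H 1 ltac:(lra)) as [N HN]. exists (1 + dnorm (u N)). intros x.
      pose proof (Hlim 1 N HN N x (le_n N)) as H1. pose proof (dnorm_bound (u N) x) as H2.
      replace (l x) with (- (pair (u N) x - l x) + pair (u N) x) by ring.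
      eapply Rle_trans; [apply Rabs_triang|]. rewrite Rabs_Ropp. lra. }
  exists (exist _ l Hdual). intros eps He. destruct (H (eps / 2) ltac:(lra)) as [N HN].
  exists N. intros n Hn.
  apply Rle_lt_trans with (eps / 2); [|lra].
  apply dnorm_least; [lra|]. intros x. rewrite pair_add, pair_scal.
  unfold pair at 2. simpl. pose proof (Hlim _ _ HN n x Hn) as Hx.
  replace (pair (u n) x + -1 * l x) with (pair (u n) x - l x) by ring. assumption.
Qed.

End DualSpace.

(** [bopp] is [dscal (-1)], which makes [dsub] and [bsub] convertible on the dual; [Defined] keeps
    the carrier transparent for [change] and [exact]. *)
Definition DualB (X : Banach) : Banach.
Proof.
  refine {| B := Dual X; bzero := dzero X; badd := @dadd X; bopp := @dscal X (-1);
            bscal := @dscal X; bnorm := @dnorm X |}.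
  1-8: abstract (intros; apply dual_ext; intros;
    rewrite ?pair_add, ?pair_scal, ?pair_add, ?pair_scal, ?pair_zero; ring).
  - apply dnorm_nonneg.
  - apply dnorm_eq0.
  - apply dnorm_scal.
  - apply dnorm_triang.
  - apply dual_complete.
Defined.

Lemma dsub_bsub (X : Banach) (f g : Dual X) : dsub f g = @bsub (DualB X) f g.
Proof. reflexivity. Qed.

Section ProductNorm.
Variables X Y : Banach.
Let pnorm (p : X * Y) := Rmax (bnorm X (fst p)) (bnorm Y (snd p)).

Lemma prod_norm_nonneg p : 0 <= pnorm p.
Proof. eapply Rle_trans; [apply bnorm_nonneg|apply Rmax_l]. Qed.

Lemma prod_norm_eq0 p : pnorm p = 0 -> p = (bzero X, bzero Y).
Proof.
  destruct p as [x y]; unfold pnorm; cbn [fst snd]. intros H.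
  pose proof (Rmax_l (bnorm X x) (bnorm Y y)). pose proof (Rmax_r (bnorm X x) (bnorm Y y)).
  pose proof (bnorm_nonneg X x). pose proof (bnorm_nonneg Y y).
  f_equal; apply bnorm_eq0; lra.
Qed.

Lemma prod_norm_scal c p : pnorm (bscal X c (fst p), bscal Y c (snd p)) = Rabs c * pnorm p.
Proof. unfold pnorm; cbn [fst snd]. rewrite !bnorm_scal. apply RmaxRmult, Rabs_pos. Qed.

Lemma prod_norm_triang p q :
  pnorm (badd X (fst p) (fst q), badd Y (snd p) (snd q)) <= pnorm p + pnorm q.
Proof.
  unfold pnorm; cbn [fst snd].
  apply Rmax_lub; (eapply Rle_trans; [apply bnorm_triang|]);
    apply Rplus_le_compat; (apply Rmax_l || apply Rmax_r).
Qed.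

Lemma prod_complete (u : nat -> X * Y) :
  (forall eps, 0 < eps -> exists N, forall m n, (N <= m)%nat -> (N <= n)%nat ->
    pnorm (badd X (fst (u m)) (bopp X (fst (u n))), badd Y (snd (u m)) (bopp Y (snd (u n)))) < eps) ->
  exists l, forall eps, 0 < eps -> exists N, forall n, (N <= n)%nat ->
    pnorm (badd X (fst (u n)) (bopp X (fst l)), badd Y (snd (u n)) (bopp Y (snd l))) < eps.
Proof.
  intros H.
  destruct (bcomplete X (fun n => fst (u n))) as [l1 H1].
  { intros eps He. destruct (H eps He) as [N HN]. exists N. intros m n Hm Hn.
    eapply Rle_lt_trans; [apply Rmax_l|]. apply (HN m n Hm Hn). }
  destruct (bcomplete Y (fun n => snd (u n))) as [l2 H2].
  { intros eps He. destruct (H eps He) as [N HN]. exists N. intros m n Hm Hn.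
    eapply Rle_lt_trans; [apply Rmax_r|]. apply (HN m n Hm Hn). }
  exists (l1, l2). intros eps He.
  destruct (H1 eps He) as [N1 HN1]. destruct (H2 eps He) as [N2 HN2].
  exists (N1 + N2)%nat. intros n Hn. unfold pnorm; cbn [fst snd].
  apply Rmax_lub_lt; [apply HN1|apply HN2]; lia.
Qed.

End ProductNorm.

(** The max norm, because a bound on it splits into bounds on the components, as [vsmall] does on
    [VS_prod]. *)
Definition ProdB (X Y : Banach) : Banach.
Proof.
  refine {| B := (X * Y)%type; bzero := (bzero X, bzero Y);
    badd := fun p q => (badd X (fst p) (fst q), badd Y (snd p) (snd q));
    bopp := fun p => (bopp X (fst p), bopp Y (snd p));
    bscal := fun c p => (bscal X c (fst p), bscal Y c (snd p));
    bnorm := fun p => Rmax (bnorm X (fst p)) (bnorm Y (snd p)) |}.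
  1-8: abstract (intros; repeat match goal with p : (_ * _)%type |- _ => destruct p end;
    cbn [fst snd]; f_equal; vec).
  - apply prod_norm_nonneg.
  - apply prod_norm_eq0.
  - apply prod_norm_scal.
  - apply prod_norm_triang.
  - apply prod_complete.
Defined.

Lemma prodB_sub (X Y : Banach) (p q : ProdB X Y) :
  bsub p q = (bsub (fst p) (fst q), bsub (snd p) (snd q)).
Proof. reflexivity. Qed.

Lemma prodB_norm_le (X Y : Banach) (p : ProdB X Y) r :
  bnorm (ProdB X Y) p <= r <-> bnorm X (fst p) <= r /\ bnorm Y (snd p) <= r.
Proof.
  cbn [ProdB bnorm]. split.
  - intros H. split; (eapply Rle_trans; [|apply H]); [apply Rmax_l|apply Rmax_r].
  - intros [H1 H2]. now apply Rmax_lub.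
Qed.

Lemma converges_pair (X Y : Banach) (u : nat -> ProdB X Y) (l : ProdB X Y) :
  converges u l <-> converges (fun n => fst (u n)) (fst l) /\ converges (fun n => snd (u n)) (snd l).
Proof.
  split.
  - intros H; split; intros eps He; destruct (H eps He) as [N HN]; exists N; intros n Hn;
      specialize (HN n Hn); rewrite prodB_sub in HN; apply prodB_norm_le in HN; apply HN.
  - intros [H1 H2] eps He. destruct (H1 eps He) as [N1 HN1]. destruct (H2 eps He) as [N2 HN2].
    exists (N1 + N2)%nat. intros n Hn. rewrite prodB_sub. apply prodB_norm_le.
    split; [apply HN1|apply HN2]; lia.
Qed.

Section LinearMaps.
Variables (X Y : Banach) (A : X -> Y).
Hypothesis HA : lin_cont A.

Lemma lin_add x y : A (badd X x y) = badd Y (A x) (A y).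
Proof. apply HA. Qed.
Lemma lin_scal c x : A (bscal X c x) = bscal Y c (A x).
Proof. apply HA. Qed.
Lemma lin_opp x : A (bopp X x) = bopp Y (A x).
Proof. rewrite !bopp_scal. apply lin_scal. Qed.
Lemma lin_sub x y : A (bsub x y) = bsub (A x) (A y).
Proof. unfold bsub. rewrite lin_add, lin_opp. reflexivity. Qed.
Lemma lin_zero : A (bzero X) = bzero Y.
Proof. rewrite <- (bscal_0l X (bzero X)), lin_scal. apply bscal_0l. Qed.
Lemma lin_bound : exists C, 0 <= C /\ forall x, bnorm Y (A x) <= C * bnorm X x.
Proof.
  destruct HA as [_ [_ [C H]]]. exists (Rabs C). split; [apply Rabs_pos|].
  intros x. eapply Rle_trans; [apply H|]. apply Rmult_le_compat_r; [apply bnorm_nonneg|].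
  apply RRle_abs.
Qed.

Lemma adjoint_ok (f : Dual Y) : is_dual X (fun x => pair f (A x)).
Proof.
  split; [|split].
  - intros. rewrite lin_add. apply pair_addr.
  - intros. rewrite lin_scal. apply pair_scalr.
  - destruct lin_bound as [C [HC H]]. destruct (dual_bounded Y f) as [D [HD Hf]].
    exists (D * C). intros x. eapply Rle_trans; [apply Hf|]. rewrite Rmult_assoc.
    apply Rmult_le_compat_l; [assumption|apply H].
Qed.

Definition adjoint (f : Dual Y) : Dual X := exist _ _ (adjoint_ok f).

Lemma pair_adjoint f x : pair (adjoint f) x = pair f (A x).
Proof. reflexivity. Qed.

End LinearMaps.

Lemma adjoint_lin_cont (X Y : Banach) (A : X -> Y) (HA : lin_cont A) :
  @lin_cont (DualB Y) (DualB X) (adjoint X Y A HA).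
Proof.
  split; [|split].
  - intros. now apply dual_ext.
  - intros. now apply dual_ext.
  - destruct (lin_bound X Y A HA) as [C [HC H]]. exists C. intros f. cbn [DualB bnorm].
    apply dnorm_least; [apply Rmult_le_pos; [assumption|apply dnorm_nonneg]|].
    intros x. rewrite pair_adjoint. eapply Rle_trans; [apply dnorm_bound|].
    rewrite (Rmult_comm C), Rmult_assoc. apply Rmult_le_compat_l; [apply dnorm_nonneg|apply H].
Qed.

(** * The Hahn-Banach theorem *)

Lemma inf_exists (E : R -> Prop) b :
  (exists r, E r) -> (forall r, E r -> b <= r) ->
  { m | (forall r, E r -> m <= r) /\ forall c, (forall r, E r -> c <= r) -> c <= m }.
Proof.
  intros Hne Hb. destruct (completeness (fun r => E (- r))) as [m [Hm1 Hm2]].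
  - exists (- b). intros r Hr. specialize (Hb _ Hr). lra.
  - destruct Hne as [r Hr]. exists (- r). now rewrite Ropp_involutive.
  - exists (- m). split.
    + intros r Hr. assert (- r <= m) by (apply Hm1; now rewrite Ropp_involutive). lra.
    + intros c Hc. assert (m <= - c) by (apply Hm2; intros r Hr; specialize (Hc _ Hr); lra). lra.
Qed.

Section HahnBanach.
Variable W : Banach.
Implicit Types (p : W -> R) (x y w : W).

Definition sublinear p :=
  (forall x y, p (badd W x y) <= p x + p y) /\ (forall c x, 0 <= c -> p (bscal W c x) <= c * p x).

(** The pattern behind all sublinear functionals below: [E w] is the set of values competing at [w],
    and the infimum inherits subadditivity and homogeneity from the competitors. The bound [b] only
    keeps the infimum finite. *)
Lemma sublinear_inf (E : W -> R -> Prop) (b : W -> R) :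
  (forall w, exists r, E w r) -> (forall w r, E w r -> b w <= r) ->
  (forall w r w' r', E w r -> E w' r' -> exists s, E (badd W w w') s /\ s <= r + r') ->
  (forall c w r, 0 <= c -> E w r -> exists s, E (bscal W c w) s /\ s <= c * r) ->
  exists p, sublinear p /\ (forall w r, E w r -> p w <= r) /\
    (forall w c, (forall r, E w r -> c <= r) -> c <= p w).
Proof.
  intros Hne Hb Hadd Hscal.
  set (p := fun w => proj1_sig (@inf_exists (E w) (b w) (Hne w) (Hb w))).
  assert (H1 : forall w r, E w r -> p w <= r)
    by (intros w; apply (proj2_sig (@inf_exists (E w) (b w) (Hne w) (Hb w)))).
  assert (H2 : forall w c, (forall r, E w r -> c <= r) -> c <= p w)
    by (intros w; apply (proj2_sig (@inf_exists (E w) (b w) (Hne w) (Hb w)))).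
  exists p. split; [split|split; assumption].
  - intros x y. assert (p (badd W x y) - p x <= p y); [|lra].
    apply H2. intros r' Hr'. assert (p (badd W x y) - r' <= p x); [|lra].
    apply H2. intros r Hr. destruct (Hadd _ _ _ _ Hr Hr') as [s [Hs Hle]].
    apply H1 in Hs. lra.
  - intros c x Hc. destruct (Rle_lt_or_eq_dec 0 c Hc) as [Hc'|<-].
    + assert (p (bscal W c x) / c <= p x).
      { apply H2. intros r Hr. destruct (Hscal c _ _ Hc Hr) as [s [Hs Hle]].
        apply H1 in Hs. apply Rmult_le_reg_l with c; [assumption|].
        replace (c * (p (bscal W c x) / c)) with (p (bscal W c x)) by (field; lra). lra. }
      replace (p (bscal W c x)) with (c * (p (bscal W c x) / c)) by (field; lra).
      apply Rmult_le_compat_l; assumption.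
    + destruct (Hne x) as [r Hr]. destruct (Hscal 0 _ _ Hc Hr) as [s [Hs Hle]].
      apply H1 in Hs. lra.
Qed.

Lemma sublinear_zero p : sublinear p -> p (bzero W) = 0.
Proof.
  intros [Ha Hs]. specialize (Ha (bzero W) (bzero W)). specialize (Hs 0 (bzero W) (Rle_refl 0)).
  rewrite bscal_0r in Hs. rewrite badd_0 in Ha. lra.
Qed.

Lemma sublinear_lower p x : sublinear p -> - p (bopp W x) <= p x.
Proof.
  intros Hp. pose proof (sublinear_zero p Hp) as H0. destruct Hp as [Ha _].
  specialize (Ha x (bopp W x)). rewrite badd_opp in Ha. lra.
Qed.

Lemma minimal_sublinear p0 : sublinear p0 ->
  exists p, sublinear p /\ (forall x, p x <= p0 x) /\
    forall q, sublinear q -> (forall x, q x <= p x) -> forall x, p x <= q x.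
Proof.
  intros H0.
  set (T := { p | sublinear p /\ forall x, p x <= p0 x }).
  set (le := fun p q : T => forall x, proj1_sig q x <= proj1_sig p x).
  assert (t0 : T) by (exists p0; split; [assumption|intros; lra]).
  (* The order [le] is the reversed pointwise order, so a maximal element is a minimal functional
     and a chain is bounded by its infimum, finite because every member dominates [w => - p0 (- w)].
     The empty chain needs the default [t0]. *)
  destruct (@classical_sets.ZL_preorder T t0
              (fun p q : T => boolp.asbool (le p q))) as [[p [Hp Hle]] Hmin].
  - intros t. apply boolp.asboolT. intros x; lra.
  - intros q r s H1 H2. apply boolp.asboolW in H1, H2. apply boolp.asboolT.
    intros x. specialize (H1 x). specialize (H2 x). lra.
  - intros C HC.
    destruct (classic (exists q, C q)) as [[q0 Hq0]|Hempty].
    + destruct (sublinear_inf (fun w r => exists q : T, C q /\ r = proj1_sig q w)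
                  (fun w => - p0 (bopp W w))) as [p [Hp [H1 H2]]].
      * intros w. exists (proj1_sig q0 w), q0. now split.
      * intros w r [[q [Hq Hqle]] [_ ->]]. simpl.
        pose proof (sublinear_lower q w Hq). specialize (Hqle (bopp W w)). lra.
      * intros w r w' r' [q [Hq ->]] [q' [Hq' ->]].
        destruct (HC q q' Hq Hq') as [H|H]; apply boolp.asboolW in H.
        -- exists (proj1_sig q' (badd W w w')). split; [exists q'; now split|].
           eapply Rle_trans; [apply (proj1 (proj2_sig q'))|].
           specialize (H w). lra.
        -- exists (proj1_sig q (badd W w w')). split; [exists q; now split|].
           eapply Rle_trans; [apply (proj1 (proj2_sig q))|].
           specialize (H w'). lra.
      * intros c w r Hc [q [Hq ->]]. exists (proj1_sig q (bscal W c w)).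
        split; [exists q; now split|]. now apply (proj1 (proj2_sig q)).
      * assert (Hp0 : forall x, p x <= p0 x).
        { intros x. eapply Rle_trans; [apply H1; exists q0; split; [assumption|reflexivity]|].
          apply (proj2_sig q0). }
        exists (exist (fun p => sublinear p /\ forall x, p x <= p0 x) p (conj Hp Hp0)). intros q Hq. apply boolp.asboolT.
        intros x. simpl. apply H1. exists q. now split.
    + exists t0. intros q Hq. exfalso. eauto.
  - exists p. split; [assumption|split; [assumption|]].
    intros q Hq Hqp x.
    assert (Hqp0 : forall x, q x <= p0 x) by (intros y; eapply Rle_trans; eauto).
    set (q' := exist (fun p => sublinear p /\ forall x, p x <= p0 x) q (conj Hq Hqp0) : T).
    specialize (Hmin q' (boolp.asboolT Hqp)). apply boolp.asboolW in Hmin. apply Hmin.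
Qed.

(** A minimal sublinear [p] is linear: [q w = inf { p (w + t y) - t p y | t >= 0 }] is sublinear and
    below [p], so minimality gives [p x <= q x <= p (x + y) - p y], the missing half of
    additivity. *)
Lemma hahn_banach p0 : sublinear p0 ->
  exists l : W -> R, (forall x y, l (badd W x y) = l x + l y) /\
    (forall c x, l (bscal W c x) = c * l x) /\ forall x, l x <= p0 x.
Proof.
  intros H0. destruct (minimal_sublinear p0 H0) as [p [Hp [Hle Hmin]]].
  assert (Hadd : forall x y, p (badd W x y) = p x + p y).
  { intros x y. apply Rle_antisym; [apply Hp|].
    destruct (sublinear_inf (fun w r => exists t, 0 <= t /\ r = p (badd W w (bscal W t y)) - t * p y)
       (fun w => - p (bopp W w))) as [q [Hq [H1 H2]]].
    - intros w. exists (p (badd W w (bscal W 0 y)) - 0 * p y), 0. split; [lra|reflexivity].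
    - intros w r [t [Ht ->]].
      pose proof (proj1 Hp (badd W w (bscal W t y)) (bopp W w)) as Ha.
      replace (badd W (badd W w (bscal W t y)) (bopp W w)) with (bscal W t y) in Ha by vec.
      destruct (Rle_lt_or_eq_dec 0 t Ht) as [Ht'|<-].
      + assert (Hs : t * p y <= p (bscal W t y)).
        { pose proof (proj2 Hp (/ t) (bscal W t y)) as Hs.
          rewrite bscal_assoc, Rinv_l, bscal_1 in Hs by lra.
          assert (0 <= / t) by (left; now apply Rinv_0_lt_compat).
          apply Rmult_le_reg_l with (/ t); [now apply Rinv_0_lt_compat|].
          rewrite <- Rmult_assoc, Rinv_l by lra. rewrite Rmult_1_l. now apply Hs. }
        lra.
      + rewrite bscal_0l, (sublinear_zero p Hp) in Ha. rewrite bscal_0l in *. lra.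
    - intros w r w' r' [t [Ht ->]] [t' [Ht' ->]]. eexists.
      split; [exists (t + t'); split; [lra|reflexivity]|].
      pose proof (proj1 Hp (badd W w (bscal W t y)) (badd W w' (bscal W t' y))) as Ha.
      replace (badd W (badd W w w') (bscal W (t + t') y)) with
        (badd W (badd W w (bscal W t y)) (badd W w' (bscal W t' y))) by vec. lra.
    - intros c w r Hc [t [Ht ->]]. eexists.
      split; [exists (c * t); split; [now apply Rmult_le_pos|reflexivity]|].
      replace (badd W (bscal W c w) (bscal W (c * t) y)) with
        (bscal W c (badd W w (bscal W t y))) by vec.
      pose proof (proj2 Hp c (badd W w (bscal W t y)) Hc). lra.
    - assert (Hqp : forall w, q w <= p w).
      { intros w. apply H1. exists 0. split; [lra|]. rewrite bscal_0l, badd_0. ring. }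
      pose proof (Hmin q Hq Hqp x) as Hx.
      assert (q x <= p (badd W x y) - p y).
      { apply H1. exists 1. split; [lra|]. rewrite bscal_1. ring. }
      lra. }
  assert (Hopp : forall x, p (bopp W x) = - p x).
  { intros x. pose proof (Hadd x (bopp W x)) as H. rewrite badd_opp, (sublinear_zero p Hp) in H. lra. }
  assert (Hpos : forall c x, 0 <= c -> p (bscal W c x) = c * p x).
  { intros c x Hc. apply Rle_antisym; [now apply Hp|].
    pose proof (proj2 Hp c (bopp W x) Hc) as H. rewrite Hopp in H.
    replace (bscal W c (bopp W x)) with (bopp W (bscal W c x)) in H by vec.
    rewrite Hopp in H. lra. }
  exists p. split; [assumption|split; [|assumption]].
  intros c x. destruct (Rle_dec 0 c) as [Hc|Hc]; [now apply Hpos|].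
  replace (bscal W c x) with (bopp W (bscal W (- c) x)) by vec.
  rewrite Hopp, Hpos by lra. ring.
Qed.

Definition convex_rel (F : W -> R -> Prop) :=
  forall x r y s l, 0 <= l <= 1 -> F x r -> F y s ->
    F (badd W (bscal W l x) (bscal W (1 - l) y)) (l * r + (1 - l) * s).

(** The functional is a linear minorant of the positively homogeneous hull of [F],
    inf-convolved with [C * norm]. *)
Lemma linear_minorant (F : W -> R -> Prop) (C : R) :
  convex_rel F -> (exists w r, F w r) -> 0 <= C ->
  (forall w r, F w r -> - (C * bnorm W w) <= r) ->
  exists f : Dual W, dnorm_le f C /\ forall w r, F w r -> pair f w <= r.
Proof.
  intros Hconv [w0 [r0 H0]] HC Hlow.
  destruct (sublinear_inf
    (fun w v => exists t q r, 0 <= t /\ F q r /\ v = t * r + C * bnorm W (bsub w (bscal W t q)))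
    (fun w => - (C * bnorm W w))) as [p [Hp [H1 _]]].
  - intros w. eexists. exists 0, w0, r0. split; [lra|split; [assumption|reflexivity]].
  - intros w v [t [q [r [Ht [Hq ->]]]]].
    pose proof (Hlow _ _ Hq) as Hl.
    pose proof (bnorm_le_sub W (bscal W t q) w) as Hn. rewrite bnorm_sub_comm in Hn.
    rewrite (bnorm_scal_pos W t q Ht) in Hn.
    apply Rmult_le_compat_l with (r := t) in Hl; [|assumption].
    apply Rmult_le_compat_l with (r := C) in Hn; [|assumption]. lra.
  - intros w v w' v' [t [q [r [Ht [Hq ->]]]]] [t' [q' [r' [Ht' [Hq' ->]]]]].
    (* The two scaled points merge into one convex combination with weight [t / (t + t')]; when both
       scalars vanish there is no such ratio, and either point serves. *)
    destruct (Rle_lt_or_eq_dec 0 (t + t') ltac:(lra)) as [Hs|Hs].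
    + eexists. split.
      * exists (t + t'), (badd W (bscal W (t / (t + t')) q) (bscal W (1 - t / (t + t')) q')),
          (t / (t + t') * r + (1 - t / (t + t')) * r').
        split; [lra|split; [|reflexivity]].
        apply Hconv; [|assumption|assumption].
        split; [apply Rmult_le_pos; [assumption|left; apply Rinv_0_lt_compat; lra]|].
        apply Rmult_le_reg_r with (t + t'); [assumption|]. unfold Rdiv.
        rewrite Rmult_assoc, Rinv_l by lra. lra.
      * replace (bsub (badd W w w') (bscal W (t + t') (badd W (bscal W (t / (t + t')) q)
             (bscal W (1 - t / (t + t')) q')))) with
          (badd W (bsub w (bscal W t q)) (bsub w' (bscal W t' q'))) by vec.
        pose proof (bnorm_triang W (bsub w (bscal W t q)) (bsub w' (bscal W t' q'))) as Hn.
        apply Rmult_le_compat_l with (r := C) in Hn; [|assumption].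
        replace ((t + t') * (t / (t + t') * r + (1 - t / (t + t')) * r')) with (t * r + t' * r')
          by (field; lra). lra.
    + assert (t = 0) by lra. assert (t' = 0) by lra. subst t t'.
      eexists. split; [exists 0, q, r; split; [lra|split; [assumption|reflexivity]]|].
      replace (bsub (badd W w w') (bscal W 0 q)) with
        (badd W (bsub w (bscal W 0 q)) (bsub w' (bscal W 0 q'))) by vec.
      pose proof (bnorm_triang W (bsub w (bscal W 0 q)) (bsub w' (bscal W 0 q'))) as Hn.
      apply Rmult_le_compat_l with (r := C) in Hn; [|assumption]. lra.
  - intros c w v Hc [t [q [r [Ht [Hq ->]]]]]. eexists.
    split; [exists (c * t), q, r; split; [now apply Rmult_le_pos|split; [assumption|reflexivity]]|].
    replace (bsub (bscal W c w) (bscal W (c * t) q)) with (bscal W c (bsub w (bscal W t q))) by vec.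
    rewrite (bnorm_scal_pos W) by assumption. lra.
  - destruct (hahn_banach p Hp) as [l [Hl1 [Hl2 Hl3]]].
    assert (Hb : forall x, l x <= C * bnorm W x).
    { intros x. eapply Rle_trans; [apply Hl3|]. apply H1. exists 0, w0, r0.
      split; [lra|split; [assumption|]].
      replace (bsub x (bscal W 0 w0)) with x by vec. ring. }
    assert (Hb' : forall x, Rabs (l x) <= C * bnorm W x).
    { intros x. apply Rabs_le. split; [|apply Hb].
      pose proof (Hb (bopp W x)) as H. rewrite bnorm_opp, bopp_scal, Hl2 in H. lra. }
    assert (Hd : is_dual W l) by (split; [assumption|split; [assumption|now exists C]]).
    exists (exist _ l Hd). split; [exact Hb'|].
    intros w r Hw. unfold pair; simpl. eapply Rle_trans; [apply Hl3|]. apply H1.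
    exists 1, w, r. split; [lra|split; [assumption|]].
    replace (bsub w (bscal W 1 w)) with (bzero W) by vec. rewrite bnorm_zero. ring.
Qed.

Definition closed_seq (L : W -> Prop) :=
  forall u l, (forall n, L (u n)) -> converges u l -> L l.

Definition subspace (L : W -> Prop) :=
  L (bzero W) /\ (forall x y, L x -> L y -> L (badd W x y)) /\ (forall c x, L x -> L (bscal W c x)).

Lemma subspace_sub L x y : subspace L -> L x -> L y -> L (bsub x y).
Proof.
  intros [_ [Ha Hs]] Hx Hy. unfold bsub. rewrite bopp_scal. auto.
Qed.

(** Closedness puts [w0] at a distance [d > 0] from [L], so the constant [- d] on [L - w0] dominates
    [- norm] and has a linear minorant [f]. Then [f <= f w0 - d] on [L]; a functional bounded above
    on a subspace vanishes there, and [0 <= f w0 - d]. *)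
Lemma separate_from_subspace (L : W -> Prop) w0 :
  subspace L -> closed_seq L -> ~ L w0 ->
  exists f : Dual W, (forall w, L w -> pair f w = 0) /\ pair f w0 <> 0.
Proof.
  intros HL Hcl Hw0.
  assert (Hd : exists d, 0 < d /\ forall w, L w -> d <= bnorm W (bsub w w0)).
  { apply NNPP. intros Hn. apply Hw0.
    assert (Hseq : forall n : nat, exists w, L w /\ bnorm W (bsub w w0) <= (/2)^n).
    { intros n. apply NNPP. intros Hn'. apply Hn. exists ((/2)^n).
      split; [apply pow_half_pos|]. intros w Hw. apply Rnot_lt_le. intros Hlt.
      apply Hn'. exists w. split; [assumption|lra]. }
    destruct (choice _ Hseq) as [u Hu].
    apply (Hcl u); [apply Hu|]. intros eps He.
    destruct (pow_half_small eps He) as [N HN]. exists N. intros n Hn0.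
    eapply Rle_trans; [apply Hu|now apply HN]. }
  destruct Hd as [d [Hd0 Hd]].
  destruct (linear_minorant (fun w r => L (badd W w w0) /\ r = - d) 1) as [f [_ Hf]].
  - intros x r y s l Hl [Hx ->] [Hy ->]. split; [|ring].
    replace (badd W (badd W (bscal W l x) (bscal W (1 - l) y)) w0) with
      (badd W (bscal W l (badd W x w0)) (bscal W (1 - l) (badd W y w0))) by vec.
    apply HL; now apply HL.
  - exists (bopp W w0), (- d). split; [|reflexivity].
    replace (badd W (bopp W w0) w0) with (bzero W) by vec. apply HL.
  - lra.
  - intros w r [Hw ->]. specialize (Hd _ Hw).
    replace (bsub (badd W w w0) w0) with w in Hd by vec. lra.
  - assert (Hf' : forall w, L w -> pair f w <= pair f w0 - d).
    { intros w Hw. specialize (Hf (bsub w w0) (- d)). rewrite pair_subr in Hf.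
      assert (pair f w - pair f w0 <= - d); [|lra]. apply Hf. split; [|reflexivity].
      now replace (badd W (bsub w w0) w0) with w by vec. }
    exists f. split.
    + intros w Hw. destruct (Req_dec (pair f w) 0) as [|Hn]; [assumption|exfalso].
      specialize (Hf' (bscal W ((pair f w0) / pair f w) w)). rewrite pair_scalr in Hf'.
      replace (pair f w0 / pair f w * pair f w) with (pair f w0) in Hf' by (field; assumption).
      assert (pair f w0 <= pair f w0 - d) by (apply Hf'; now apply HL). lra.
    + specialize (Hf' (bzero W) (proj1 HL)). rewrite pair_zeror in Hf'. lra.
Qed.

End HahnBanach.

(** * Baire category and open mappings *)

Lemma dependent_choice (T : Type) (Inv : T -> Prop) (Rel : nat -> T -> T -> Prop) (a : T) :
  Inv a -> (forall n x, Inv x -> exists y, Inv y /\ Rel n x y) ->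
  exists f : nat -> T, f O = a /\ (forall n, Inv (f n)) /\ forall n, Rel n (f n) (f (S n)).
Proof.
  intros Ha Hs.
  assert (Hstep : forall n x, { y | Inv x -> Inv y /\ Rel n x y }).
  { intros n x. apply constructive_indefinite_description.
    destruct (classic (Inv x)) as [Hx|Hx].
    - destruct (Hs n x Hx) as [y Hy]. now exists y.
    - exists x. now intros. }
  set (f := fix f n := match n with O => a | S k => proj1_sig (Hstep k (f k)) end).
  assert (Hf : forall n, Inv (f n)).
  { induction n as [|n IH]; [assumption|]. apply (proj2_sig (Hstep n (f n)) IH). }
  exists f. split; [reflexivity|split; [assumption|]].
  intros n. apply (proj2_sig (Hstep n (f n)) (Hf n)).
Qed.

Lemma converges_bound (X : Banach) (u : nat -> X) l x r N :
  converges u l -> (forall n, (N <= n)%nat -> bnorm X (bsub (u n) x) <= r) ->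
  bnorm X (bsub l x) <= r.
Proof.
  intros Hu Hb. apply le_epsilon. intros eps He. destruct (Hu eps He) as [M HM].
  specialize (HM (N + M)%nat ltac:(lia)). specialize (Hb (N + M)%nat ltac:(lia)).
  rewrite bnorm_sub_comm in HM.
  pose proof (bnorm_sub_triang X l (u (N + M)%nat) x). lra.
Qed.

Lemma converges_norm_le (X : Banach) (u : nat -> X) l r :
  converges u l -> (forall n, bnorm X (u n) <= r) -> bnorm X l <= r.
Proof.
  intros Hu Hb. replace l with (bsub l (bzero X)) by vec.
  apply converges_bound with u O; [assumption|]. intros n _.
  replace (bsub (u n) (bzero X)) with (u n) by vec. apply Hb.
Qed.

(** If no [E n] were dense in a ball of [L], every ball would contain a smaller one, centred in [L],
    that misses [E n]; the centres of such nested balls converge to a point of [L] outside all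
    [E n]. Density is spelled out by approximation, so that no closures have to be formed. *)
Lemma baire (W : Banach) (L : W -> Prop) (E : nat -> W -> Prop) :
  closed_seq W L -> (exists w, L w) -> (forall w, L w -> exists n, E n w) ->
  exists n w r, L w /\ 0 < r /\ forall w', L w' -> bnorm W (bsub w' w) <= r ->
    forall eps, 0 < eps -> exists v, E n v /\ bnorm W (bsub w' v) <= eps.
Proof.
  intros Hcl [w0 Hw0] Hcov. apply NNPP. intros Hno.
  assert (Hgap : forall n w r, L w -> 0 < r -> exists w' eps, L w' /\ bnorm W (bsub w' w) <= r /\
     0 < eps /\ forall v, E n v -> eps < bnorm W (bsub w' v)).
  { intros n w r Hw Hr. apply NNPP. intros Hno'. apply Hno.
    exists n, w, r. split; [assumption|split; [assumption|]].
    intros w' Hw' Hle eps He. apply NNPP. intros Hno''. apply Hno'.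
    exists w', eps. do 3 (split; [assumption|]).
    intros v Hv. apply Rnot_le_lt. intros Hle'. apply Hno''. now exists v. }
  destruct (@dependent_choice (W * R) (fun p => L (fst p) /\ 0 < snd p)
    (fun n p q => bnorm W (bsub (fst q) (fst p)) + snd q <= snd p /\ snd q <= / 2 * snd p /\
        forall v, E n v -> snd q < bnorm W (bsub (fst q) v)) (w0, 1)) as [f [Hf0 [Hinv Hrel]]].
  - split; [assumption|simpl; lra].
  - intros n [w r] [Hw Hr]. cbn [fst snd] in *.
    destruct (Hgap n w (r / 2) Hw ltac:(lra)) as [w' [eps [H1 [H2 [H3 H4]]]]].
    (* Centre moved by at most [r / 2] and radius at most [r / 2]: the new ball stays inside the old
       one and the radii are summable. *)
    exists (w', Rmin (r / 2) eps). cbn [fst snd].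
    pose proof (Rmin_l (r / 2) eps). pose proof (Rmin_r (r / 2) eps).
    split; [split; [assumption|apply Rmin_glb_lt; lra]|].
    split; [lra|split; [lra|]]. intros v Hv. specialize (H4 v Hv). lra.
  - assert (Hr : forall n, snd (f n) <= (/2)^n).
    { induction n as [|n IH]; cbn [pow]; [rewrite Hf0; simpl; lra|].
      destruct (Hrel n) as [_ [H _]]. lra. }
    assert (Hnest : forall n k, bnorm W (bsub (fst (f (k + n)%nat)) (fst (f n))) + snd (f (k + n)%nat)
              <= snd (f n)).
    { intros n; induction k as [|k IH]; cbn [Nat.add].
      - replace (bsub (fst (f n)) (fst (f n))) with (bzero W) by vec. rewrite bnorm_zero. lra.
      - destruct (Hrel (k + n)%nat) as [H _].
        pose proof (bnorm_sub_triang W (fst (f (S (k + n)))) (fst (f (k + n)%nat)) (fst (f n))). lra. }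
    destruct (geometric_converges W (fun n => fst (f n)) 1) as [l [Hl _]].
    { intros n. destruct (Hrel n) as [H _]. specialize (Hr n).
      pose proof (proj2 (Hinv (S n))). lra. }
    destruct (Hcov l) as [n Hn].
    { apply (Hcl (fun n => fst (f n))); [apply Hinv|assumption]. }
    destruct (Hrel n) as [_ [_ H]]. specialize (H l Hn).
    assert (bnorm W (bsub l (fst (f (S n)))) <= snd (f (S n))).
    { apply converges_bound with (fun n => fst (f n)) (S n); [assumption|].
      intros m Hm. replace m with ((m - S n) + S n)%nat by lia.
      pose proof (Hnest (S n) (m - S n)%nat). pose proof (proj2 (Hinv ((m - S n) + S n)%nat)). lra. }
    rewrite bnorm_sub_comm in H. lra.
Qed.

Definition convex_set (W : Banach) (C : W -> Prop) :=
  forall x y l, 0 <= l <= 1 -> C x -> C y -> C (badd W (bscal W l x) (bscal W (1 - l) y)).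

Section OpenMapping.
Variables (Q W : Banach) (P : Q -> W) (L : W -> Prop).
Hypothesis HP : lin_cont P.
Hypothesis HL : subspace W L.

(** Convex series: [w] is the sum of the [2^-(k+1) P (q k)], where [q k] approximates twice the
    remainder left by the previous terms, rescaled to the original radius. *)
Lemma open_of_dense (C : Q -> Prop) N r :
  convex_set Q C -> closed_seq Q C -> (forall q, C q -> bnorm Q q <= N) ->
  (forall q, C q -> L (P q)) -> 0 < r ->
  (forall w, L w -> bnorm W w <= r -> forall eps, 0 < eps ->
      exists q, C q /\ bnorm W (bsub w (P q)) <= eps) ->
  forall w, L w -> bnorm W w <= r / 2 -> exists q, C q /\ P q = w.
Proof.
  intros Hconv Hcl HN HCL Hr Hdense w Hw Hwr.
  pose (half := fun n => (/2)^n).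
  destruct (@dependent_choice (Q * W)
    (fun s => L (snd s) /\ bnorm W (snd s) <= r)
    (fun n s s' => exists q, C q /\ fst s' = badd Q (fst s) (bscal Q (half (S n)) q) /\
        snd s' = bscal W 2 (bsub (snd s) (P q)))
    (bzero Q, bscal W 2 w)) as [f [Hf0 [Hinv Hrel]]].
  - cbn [fst snd]. split; [now apply HL|]. rewrite bnorm_scal_pos; lra.
  - intros n [s e] [He Her]. cbn [fst snd] in *.
    destruct (Hdense e He Her (r / 2) ltac:(lra)) as [q [Hq Hqe]].
    eexists (_, _). split; [|exists q; split; [assumption|split; reflexivity]].
    cbn [fst snd]. split.
    + apply HL. apply subspace_sub; auto.
    + rewrite bnorm_scal_pos; lra.
  - destruct (Hdense w Hw ltac:(lra) 1 ltac:(lra)) as [q0 [Hq0 _]].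
    (* The partial sum [fst (f n)] carries total weight [1 - 2^-n], so any point of [C] with weight
       [2^-n] completes it to a convex combination. The fixed point [q0] is this filler on the way
       to the limit. *)
    assert (Hmem : forall n q, C q -> C (badd Q (fst (f n)) (bscal Q (half n) q))).
    { induction n as [|n IH]; intros q Hq.
      - rewrite Hf0. cbn [fst]. replace (badd Q (bzero Q) (bscal Q (half O) q)) with q; [assumption|].
        unfold half; cbn [pow]. vec.
      - destruct (Hrel n) as [q' [Hq' [-> _]]].
        replace (badd Q (badd Q (fst (f n)) (bscal Q (half (S n)) q')) (bscal Q (half (S n)) q))
          with (badd Q (fst (f n)) (bscal Q (half n)
                  (badd Q (bscal Q (/2) q') (bscal Q (1 - /2) q)))).
        + apply IH. apply Hconv; [lra|assumption|assumption].
        + unfold half; cbn [pow]. vec. }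
    (* Invariant of the series: the remainder after [n] terms is [2^-(n+1)] times the rescaled error
       [snd (f n)], whose norm stays below [r]. *)
    assert (Hsum : forall n, badd W (P (fst (f n))) (bscal W (half (S n)) (snd (f n))) = w).
    { induction n as [|n IH].
      - rewrite Hf0. cbn [fst snd]. rewrite (lin_zero _ _ _ HP). unfold half; cbn [pow]. vec.
      - rewrite <- IH. destruct (Hrel n) as [q' [Hq' [-> ->]]].
        rewrite (lin_add _ _ _ HP), (lin_scal _ _ _ HP). unfold half; cbn [pow]. vec. }
    assert (HN0 : 0 <= N) by (eapply Rle_trans; [apply (bnorm_nonneg Q q0)|auto]).
    destruct (geometric_converges Q (fun n => fst (f n)) (/2 * N)) as [q [Hq Hqn]].
    { intros n. destruct (Hrel n) as [q' [Hq' [-> _]]].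
      replace (bsub (badd Q (fst (f n)) (bscal Q (half (S n)) q')) (fst (f n)))
        with (bscal Q (half (S n)) q') by vec.
      pose proof (pow_half_pos (S n)). rewrite bnorm_scal_pos by (unfold half; lra).
      apply Rle_trans with (half (S n) * N); [apply Rmult_le_compat_l; unfold half; auto; lra|].
      unfold half; cbn [pow]. right; ring. }
    exists q. split.
    + apply (Hcl (fun n => badd Q (fst (f n)) (bscal Q (half n) q0))); [auto|].
      intros eps He. destruct (pow_half_small (eps / (2 * N + 1))) as [M HM].
      { apply Rdiv_lt_0_compat; lra. }
      exists M. intros n Hn. specialize (HM n Hn).
      replace (bsub (badd Q (fst (f n)) (bscal Q (half n) q0)) q) with
        (badd Q (bsub (fst (f n)) q) (bscal Q (half n) q0)) by vec.
      eapply Rle_trans; [apply bnorm_triang|]. specialize (Hqn n).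
      pose proof (pow_half_pos n). rewrite bnorm_scal_pos by (unfold half; lra).
      specialize (HN _ Hq0). unfold half.
      assert ((/2)^n * bnorm Q q0 <= (/2)^n * N) by (apply Rmult_le_compat_l; lra).
      assert ((/2)^n * (2 * N + 1) <= eps).
      { replace eps with (eps / (2 * N + 1) * (2 * N + 1)) by (field; lra).
        apply Rmult_le_compat_r; lra. }
      lra.
    + destruct (lin_bound _ _ _ HP) as [K [HK HPK]].
      apply bsub_eq0. apply Rle_antisym; [|apply bnorm_nonneg]. apply le_epsilon.
      intros eps He. rewrite Rplus_0_l.
      destruct (pow_half_small (eps / (K * N + r + 1))) as [M HM].
      { apply Rdiv_lt_0_compat; [assumption|]. pose proof (Rmult_le_pos _ _ HK HN0). lra. }
      specialize (HM M (le_n M)). rewrite <- (Hsum M).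
      replace (bsub (P q) (badd W (P (fst (f M))) (bscal W (half (S M)) (snd (f M))))) with
        (bsub (P (bsub q (fst (f M)))) (bscal W (half (S M)) (snd (f M))))
        by (rewrite (lin_sub _ _ _ HP); vec).
      eapply Rle_trans; [apply bnorm_sub_le|].
      pose proof (HPK (bsub q (fst (f M)))) as H1. specialize (Hqn M). cbv beta in Hqn. rewrite bnorm_sub_comm in Hqn.
      apply Rmult_le_compat_l with (r := K) in Hqn; [|assumption].
      pose proof (pow_half_pos M). pose proof (pow_half_pos (S M)).
      rewrite bnorm_scal_pos by (unfold half; lra).
      destruct (Hinv M) as [_ H2].
      apply Rmult_le_compat_l with (r := half (S M)) in H2; [|unfold half; lra].
      unfold half in *. cbn [pow] in *.
      assert ((/2)^M * (K * N + r + 1) <= eps).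
      { replace eps with (eps / (K * N + r + 1) * (K * N + r + 1))
          by (field; pose proof (Rmult_le_pos _ _ HK HN0); lra).
        apply Rmult_le_compat_r; [pose proof (Rmult_le_pos _ _ HK HN0)|]; lra. }
      assert (0 <= (/2)^M * r) by (apply Rmult_le_pos; lra). lra.
Qed.

(** Multiples of the images of the [C n] cover [L], so by Baire one of them is dense in some ball of
    [L]. Convexity moves that ball to the origin, and [open_of_dense] replaces density by
    equality. *)
Lemma open_mapping (C : nat -> Q -> Prop) :
  closed_seq W L ->
  (forall n, convex_set Q (C n)) -> (forall n, closed_seq Q (C n)) ->
  (forall n q, C n q -> bnorm Q q <= INR n) ->
  (forall m n q, (m <= n)%nat -> C m q -> C n q) ->
  (forall n q, C n q -> L (P q)) ->
  (forall w, L w -> exists n q l, C n q /\ 0 < l /\ P q = bscal W l w) ->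
  exists n r, 0 < r /\ forall w, L w -> bnorm W w <= r -> exists q, C n q /\ P q = w.
Proof.
  intros HLcl Hconv Hcl Hb Hmono HCL Habs.
  (* [q0] is sent to 0: mixing a point with [q0] shrinks its image inside a convex level, which the
     levels alone do not allow since 0 need not belong to them. *)
  destruct (Habs (bzero W) (proj1 HL)) as [n0 [q0 [l0 [Hq0 [_ HPq0]]]]].
  rewrite bscal_0r in HPq0.
  assert (Habs' : forall w, L w -> exists n q, C n q /\ bscal W (INR (S n)) (P q) = w).
  { intros w Hw. destruct (Habs w Hw) as [m [q [l [Hq [Hl HPq]]]]].
    destruct (INR_unbounded (/ l)) as [k Hk].
    set (n := (m + n0 + k)%nat). exists n.
    assert (HSn : 0 < INR (S n)) by (apply lt_0_INR; lia).
    (* Chosen so that [INR (S n) * t * l = 1]; the summand [k > / l] in [n] ensures [t <= 1]. *)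
    set (t := / (INR (S n) * l)).
    assert (Hnl : 1 <= INR (S n) * l).
    { apply Rmult_le_reg_r with (/ l); [now apply Rinv_0_lt_compat|].
      rewrite Rmult_assoc, Rinv_r by lra.
      assert (INR k <= INR (S n)) by (apply le_INR; lia). lra. }
    exists (badd Q (bscal Q t q) (bscal Q (1 - t) q0)). split.
    - apply Hconv.
      + split; [left; apply Rinv_0_lt_compat; lra|]. unfold t. rewrite <- Rinv_1.
        apply Rinv_le_contravar; lra.
      + apply Hmono with m; [lia|assumption].
      + apply Hmono with n0; [lia|assumption].
    - rewrite (lin_add _ _ _ HP), !(lin_scal _ _ _ HP), HPq, HPq0. unfold t. vec. }
  destruct (baire W L (fun n w => exists q, C n q /\ bscal W (INR (S n)) (P q) = w))
    as [n [w0 [r [Hw0 [Hr Hdense]]]]]; [assumption|now exists (bzero W); apply HL|assumption|].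
  (* A preimage of a multiple of [- w0]: averaging it with the dense set, with weights proportional
     to [INR (S n)] and [INR (S m)], cancels the centre [w0]. *)
  destruct (Habs' (bopp W w0)) as [m [q1 [Hq1 HPq1]]].
  { rewrite bopp_scal. now apply HL. }
  set (k := (n + m)%nat). set (s := INR (S n) + INR (S m)).
  assert (Hsn : 0 < INR (S n)) by (apply lt_0_INR; lia).
  assert (Hsm : 0 < INR (S m)) by (apply lt_0_INR; lia).
  exists k, (r / s / 2). split; [unfold s; repeat apply Rdiv_lt_0_compat; lra|].
  apply (open_of_dense (C k) (INR k)); auto.
  - apply HCL.
  - unfold s; apply Rdiv_lt_0_compat; lra.
  - intros w Hw Hwr eps He.
    destruct (Hdense (badd W (bscal W s w) w0)) with (eps := s * eps) as [v [[q [Hq HPq]] Hv]].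
    + apply HL; [now apply HL|assumption].
    + replace (bsub (badd W (bscal W s w) w0) w0) with (bscal W s w) by vec.
      rewrite bnorm_scal_pos by (unfold s; lra).
      apply Rmult_le_compat_l with (r := s) in Hwr; [|unfold s; lra].
      replace (s * (r / s)) with r in Hwr by (unfold s; field; lra). assumption.
    + apply Rmult_lt_0_compat; unfold s; lra.
    + exists (badd Q (bscal Q (INR (S n) / s) q) (bscal Q (1 - INR (S n) / s) q1)). split.
      * apply Hconv.
        -- split; [unfold s; left; apply Rdiv_lt_0_compat; lra|].
           apply Rmult_le_reg_r with s; [unfold s; lra|].
           unfold Rdiv. rewrite Rmult_assoc, Rinv_l by (unfold s; lra). unfold s; lra.
        -- apply Hmono with n; [unfold k; lia|assumption].
        -- apply Hmono with m; [unfold k; lia|assumption].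
      * rewrite <- HPq in Hv.
        replace (bsub (badd W (bscal W s w) w0) (bscal W (INR (S n)) (P q))) with
          (bscal W s (bsub w (P (badd Q (bscal Q (INR (S n) / s) q)
             (bscal Q (1 - INR (S n) / s) q1))))) in Hv.
        -- rewrite bnorm_scal_pos in Hv by (unfold s; lra).
           apply Rmult_le_reg_l with s; [unfold s; lra|assumption].
        -- rewrite (lin_add _ _ _ HP), !(lin_scal _ _ _ HP).
           replace w0 with (bscal W (-1) (bscal W (INR (S m)) (P q1)))
             by (rewrite HPq1; vec).
           assert (INR (S m) = s - INR (S n)) as -> by (unfold s; ring).
           assert (s <> 0) by (unfold s; lra).
           vec; field; assumption.
Qed.

End OpenMapping.

(** * Strong representatives through their epigraphs *)

Notation bipair phi f := (proj1_sig phi f) (only parsing).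

Lemma bipair_add (X : Banach) (phi : Bidual X) f g : bipair phi (dadd f g) = bipair phi f + bipair phi g.
Proof. apply (proj2_sig phi). Qed.
Lemma bipair_scal (X : Banach) (phi : Bidual X) c f : bipair phi (dscal c f) = c * bipair phi f.
Proof. apply (proj2_sig phi). Qed.
Lemma bipair_sub (X : Banach) (phi : Bidual X) f g : bipair phi (dsub f g) = bipair phi f - bipair phi g.
Proof. unfold dsub. rewrite bipair_add, bipair_scal. ring. Qed.
Lemma bipair_zero (X : Banach) (phi : Bidual X) : bipair phi (dzero X) = 0.
Proof.
  replace (dzero X) with (dscal 0 (dzero X)) by (apply dual_ext; intros; rewrite pair_scal, pair_zero; ring).
  rewrite bipair_scal. ring.
Qed.

Tactic Notation "pairs" :=
  rewrite ?pair_sub, ?pair_add, ?pair_scal, ?pair_subr, ?pair_addr, ?pair_scalr,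
    ?pair_sub, ?pair_add, ?pair_scal.
Tactic Notation "pairs" "in" hyp(H) :=
  rewrite ?pair_sub, ?pair_add, ?pair_scal, ?pair_subr, ?pair_addr, ?pair_scalr,
    ?pair_sub, ?pair_add, ?pair_scal in H.

Lemma ER_le_trans a r s : ER_le a r -> r <= s -> ER_le a s.
Proof. destruct a; simpl; [lra|tauto]. Qed.
Lemma ER_le_eps a r : (forall eps, 0 < eps -> ER_le a (r + eps)) -> ER_le a r.
Proof.
  destruct a; simpl; intros H; [now apply le_epsilon|]. now apply (H 1 ltac:(lra)).
Qed.
Lemma dom_ER_le (X : Banach) (h : X -> Dual X -> ER) x f : dom h x f <-> exists r, ER_le (h x f) r.
Proof.
  unfold dom. split.
  - intros [r ->]. exists r. simpl. lra.
  - intros [r Hr]. destruct (h x f) as [s|]; [now exists s|destruct Hr].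
Qed.

(** [F x f r] stands for [h (x, f) <= r]. Working with admissible bounds avoids arithmetic on
    extended values and makes the class stable under the translations below. *)
Record strong_epi {X : Banach} (S : MOp X) (F : X -> Dual X -> R -> Prop) : Prop := {
  epi_convex : forall x f r y g s l, 0 <= l <= 1 -> F x f r -> F y g s ->
    F (badd X (bscal X l x) (bscal X (1 - l) y)) (dadd (dscal l f) (dscal (1 - l) g))
      (l * r + (1 - l) * s);
  epi_up : forall x f r s, F x f r -> r <= s -> F x f s;
  epi_closed : forall a (u : nat -> X) (us : nat -> DualB X) x f,
    (forall n, F (u n) (us n) a) -> converges u x -> converges us f -> F x f a;
  epi_ge : forall x f r, F x f r -> pair f x <= r;
  epi_graph : forall x f, S x f -> F x f (pair f x);
  epi_strong : forall f (phi : Bidual X) eps, 0 < eps -> exists x g r, F x g r /\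
    bipair phi f - eps < pair f x + bipair phi g - r
}.

Definition shift_op {X : Banach} (S : MOp X) (x0 : X) (f0 : Dual X) : MOp X :=
  fun x f => S (badd X x x0) (dadd f f0).

(** The three added terms are [<f + f0, x + x0> - <f, x>]: the translated function exceeds the
    coupling by as much as [h] does at the translated point. *)
Definition shift_epi {X : Banach} (h : X -> Dual X -> ER) (x0 : X) (f0 : Dual X) :=
  fun x f r => ER_le (h (badd X x x0) (dadd f f0)) (r + pair f x0 + pair f0 x + pair f0 x0).

Lemma shift_maximal (X : Banach) (S : MOp X) x0 f0 :
  maximal_monotone S -> maximal_monotone (shift_op S x0 f0).
Proof.
  intros [Hm Hmax]. split.
  - intros x f y g Hx Hy. pose proof (Hm _ _ _ _ Hx Hy) as H.
    pairs in H. pairs. lra.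
  - intros x f H. apply Hmax. intros y g Hy.
    specialize (H (bsub y x0) (dsub g f0)).
    pairs in H. pairs.
    assert (Hs : shift_op S x0 f0 (bsub y x0) (dsub g f0)).
    { unfold shift_op. replace (badd X (bsub y x0) x0) with y by vec.
      replace (dadd (dsub g f0) f0) with g; [assumption|].
      apply dual_ext. intros z. rewrite pair_add, pair_sub. ring. }
    specialize (H Hs). lra.
Qed.

(** The element [phi + x0] of the bidual, at which strongness of [h] is invoked to obtain strongness
    of its translate at [phi]. *)
Lemma shift_bidual_ok (X : Banach) (phi : Bidual X) (x0 : X) :
  @is_bidual X (fun f => bipair phi f + pair f x0).
Proof.
  split; [|split].
  - intros. rewrite bipair_add, pair_add. ring.
  - intros. rewrite bipair_scal, pair_scal. ring.
  - destruct (proj2_sig phi) as [_ [_ [C H]]]. exists (C + bnorm X x0). intros f M HM Hf.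
    eapply Rle_trans; [apply Rabs_triang|]. specialize (H f M HM Hf). specialize (Hf x0). lra.
Qed.

Lemma pair_sub_le (X : Banach) (f g : Dual X) x y :
  Rabs (pair f x - pair g y) <= dnorm X (dsub f g) * bnorm X x + dnorm X g * bnorm X (bsub x y).
Proof.
  replace (pair f x - pair g y) with (pair (dsub f g) x + pair g (bsub x y))
    by (rewrite pair_sub, pair_subr; ring).
  eapply Rle_trans; [apply Rabs_triang|]. apply Rplus_le_compat; apply dnorm_bound.
Qed.

Lemma pair_converges (X : Banach) (u : nat -> X) (us : nat -> DualB X) x (f : DualB X) :
  converges u x -> converges us f -> Un_cv (fun n => pair (us n) (u n)) (pair f x).
Proof.
  intros Hu Hus eps He.
  set (K := dnorm X f + bnorm X x + 2).
  pose proof (dnorm_nonneg X f) as Hf0. pose proof (bnorm_nonneg X x) as Hx0.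
  assert (HK : 0 < K) by (unfold K; lra).
  set (d := Rmin 1 (eps / K / 2)).
  assert (Hd : 0 < d).
  { unfold d. apply Rmin_glb_lt; [lra|]. repeat apply Rdiv_lt_0_compat; lra. }
  destruct (Hu d Hd) as [N HN]. destruct (Hus d Hd) as [N' HN'].
  exists (N + N')%nat. intros n Hn. unfold Rdist.
  specialize (HN n ltac:(lia)). specialize (HN' n ltac:(lia)).
  change (dnorm X (dsub (us n) f) <= d) in HN'.
  eapply Rle_lt_trans; [apply pair_sub_le|].
  assert (H1 : d <= 1) by apply Rmin_l. assert (H2 : d <= eps / K / 2) by apply Rmin_r.
  pose proof (bnorm_le_sub X (u n) x).
  assert (dnorm X (dsub (us n) f) * bnorm X (u n) <= d * (1 + bnorm X x)).
  { apply Rmult_le_compat; [apply dnorm_nonneg|apply bnorm_nonneg|assumption|lra]. }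
  assert (dnorm X f * bnorm X (bsub (u n) x) <= dnorm X f * d) by (apply Rmult_le_compat_l; lra).
  assert (d * K <= eps / 2).
  { apply Rle_trans with (eps / K / 2 * K); [apply Rmult_le_compat_r; lra|right; field; lra]. }
  unfold K in *. lra.
Qed.

Lemma converges_const (X : Banach) (x : X) : converges (fun _ => x) x.
Proof.
  intros eps He. exists O. intros. replace (bsub x x) with (bzero X) by vec.
  rewrite bnorm_zero. lra.
Qed.

Lemma shift_strong_epi (X : Banach) (S : MOp X) h x0 f0 :
  strong_representative S h -> strong_epi (shift_op S x0 f0) (shift_epi h x0 f0).
Proof.
  intros [[Hconv [Hlsc [Hge Hgr]]] Hst]. split; unfold shift_epi, shift_op.
  - intros x f r y g s l Hl Hx Hy. pose proof (Hconv _ _ _ _ _ _ l Hl Hx Hy) as H.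
    replace (badd X (badd X (bscal X l x) (bscal X (1 - l) y)) x0) with
      (badd X (bscal X l (badd X x x0)) (bscal X (1 - l) (badd X y x0))) by vec.
    replace (dadd (dadd (dscal l f) (dscal (1 - l) g)) f0) with
      (dadd (dscal l (dadd f f0)) (dscal (1 - l) (dadd g f0)))
      by (apply dual_ext; intros; rewrite !pair_add, !pair_scal, !pair_add; ring).
    eapply ER_le_trans; [apply H|]. pairs. lra.
  - intros x f r s H Hrs. eapply ER_le_trans; [apply H|lra].
  (* The level of [h] varies along the sequence through the pairings with [x0] and [f0]. It is
     frozen at its limit plus [eps] by starting the sequence late enough, and [eps] is removed at
     the end. *)
  - intros a u us x f H Hu Hus. apply ER_le_eps. intros eps He.
    pose proof (pair_converges X (fun _ => x0) us x0 f (converges_const X x0) Hus (eps / 2) ltac:(lra)) as [N1 H1].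
    pose proof (pair_converges X u (fun _ => f0) x f0 Hu (converges_const (DualB X) f0) (eps / 2) ltac:(lra)) as [N2 H2].
    unfold Rdist in *.
    apply (Hlsc _ (fun n => badd X (u (N1 + N2 + n)%nat) x0) (fun n => dadd (us (N1 + N2 + n)%nat) f0)).
    + intros n. eapply ER_le_trans; [apply H|].
      specialize (H1 (N1 + N2 + n)%nat ltac:(lia)). specialize (H2 (N1 + N2 + n)%nat ltac:(lia)).
      apply Rabs_def2 in H1, H2. lra.
    + intros e He'. destruct (Hu e He') as [M1 HM1]. destruct (Hus e He') as [M2 HM2].
      exists (M1 + M2)%nat. intros n Hn.
      specialize (HM1 (N1 + N2 + n)%nat ltac:(lia)). specialize (HM2 (N1 + N2 + n)%nat ltac:(lia)).
      split.
      * replace (bsub (badd X (u (N1 + N2 + n)%nat) x0) (badd X x x0)) with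
          (bsub (u (N1 + N2 + n)%nat) x) by vec. assumption.
      * apply dnorm_le_iff; [lra|].
        replace (dsub (dadd (us (N1 + N2 + n)%nat) f0) (dadd f f0)) with
          (dsub (us (N1 + N2 + n)%nat) f); [assumption|].
        apply dual_ext; intros; rewrite !pair_sub, !pair_add; ring.
  - intros x f r H. pose proof (Hge (badd X x x0) (dadd f f0)) as Hc.
    rewrite !pair_add, !pair_addr in Hc. destruct (h _ _); simpl in *; [lra|tauto].
  - intros x f H. rewrite (Hgr _ _ H). cbn [ER_le]. pairs. lra.
  - intros f phi eps He.
    destruct (Hst (dadd f f0) (exist _ _ (shift_bidual_ok X phi x0)) eps He) as [x [g [r [Hr Hlt]]]].
    cbn [proj1_sig] in Hlt. rewrite !bipair_add in Hlt. pairs in Hlt.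
    exists (bsub x x0), (dsub g f0), (r - pair (dsub g f0) x0 - pair f0 (bsub x x0) - pair f0 x0).
    replace (badd X (bsub x x0) x0) with x by vec.
    replace (dadd (dsub g f0) f0) with g
      by (apply dual_ext; intros; rewrite pair_add, pair_sub; ring).
    rewrite Hr. cbn [ER_le]. rewrite bipair_sub. pairs. split; lra.
Qed.

Lemma linear_bounded_above k c : (forall t, t * k <= c) -> k = 0.
Proof.
  intros H. destruct (Req_dec k 0) as [|Hk]; [assumption|].
  specialize (H ((c + 1) / k)). replace ((c + 1) / k * k) with (c + 1) in H by (field; assumption). lra.
Qed.

(** The infimum of [<e, x> + |x|^2/2] is [- |e|^2/2], in general not attained. With [m = |e|], a
    vector of norm [m] on which [e] is at most [- m m'] leaves the error [m (m - m')], and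
    [m' >= m - d / m] makes it at most [d]. *)
Lemma almost_norming (X : Banach) (e : Dual X) d : 0 < d ->
  exists x, pair e x + / 2 * (bnorm X x)^2 + / 2 * (dnorm X e)^2 <= d.
Proof.
  intros Hd. set (m := dnorm X e). assert (Hm : 0 <= m) by apply dnorm_nonneg.
  destruct (Rle_lt_or_eq_dec 0 m Hm) as [Hm'|Hm'].
  - set (m' := Rmax 0 (m - d / m)).
    assert (Hdm : 0 < d / m) by (apply Rdiv_lt_0_compat; lra).
    assert (Hlt : m' < m) by (apply Rmax_lub_lt; lra).
    assert (Hn : ~ dnorm_le e m').
    { intros H. apply dnorm_least in H; [fold m in H; lra|apply Rmax_l]. }
    apply not_all_ex_not in Hn. destruct Hn as [x Hx]. apply Rnot_le_lt in Hx.
    assert (Hx0 : 0 < bnorm X x).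
    { destruct (Rle_lt_or_eq_dec 0 _ (bnorm_nonneg X x)) as [|H]; [assumption|exfalso].
      symmetry in H. apply bnorm_eq0 in H. subst x.
      rewrite pair_zeror, bnorm_zero, Rabs_R0 in Hx. lra. }
    assert (Hmm : m * (m - m') <= d).
    { assert (m - d / m <= m') by apply Rmax_r.
      replace d with (m * (d / m)) by (field; lra). apply Rmult_le_compat_l; lra. }
    assert (Hsgn : exists y, bnorm X y = bnorm X x /\ pair e y = - Rabs (pair e x)).
    { destruct (Rle_dec 0 (pair e x)).
      - exists (bopp X x). rewrite bnorm_opp, pair_oppr, Rabs_right by lra. now split.
      - exists x. rewrite Rabs_left by lra. split; [reflexivity|ring]. }
    destruct Hsgn as [y [Hy1 Hy2]].
    exists (bscal X (m / bnorm X x) y).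
    assert (Hq : 0 < m / bnorm X x) by (apply Rdiv_lt_0_compat; lra).
    rewrite pair_scalr, bnorm_scal_pos, Hy1, Hy2 by lra.
    replace (m / bnorm X x * bnorm X x) with m by (field; lra).
    apply Rmult_lt_compat_l with (r := m / bnorm X x) in Hx; [|assumption].
    replace (m / bnorm X x * (m' * bnorm X x)) with (m * m') in Hx by (field; lra). lra.
  - exists (bzero X). rewrite pair_zeror, bnorm_zero, <- Hm'. lra.
Qed.

(** * Solvability of the inclusion *)

Definition TripleB (X Y : Banach) : Banach := ProdB (ProdB Y (DualB Y)) (DualB X).
Definition SourceB (X Y : Banach) : Banach :=
  ProdB (ProdB X (DualB X)) (ProdB (ProdB X (DualB Y)) (ProdB Y (DualB Y))).

(** Here the biduals enter: the second and third coordinates range over dual spaces, so a functional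
    acts on them through elements of [Bidual Y] and [Bidual X]. *)
Lemma triple_dual (X Y : Banach) (f : Dual (TripleB X Y)) :
  exists (bs : Dual Y) (bss : Bidual Y) (ass : Bidual X),
    forall y ys us, pair f ((y, ys), us) = pair bs y + bipair bss ys + bipair ass us.
Proof.
  destruct (dual_bounded (TripleB X Y) f) as [D [HD HfD]].
  assert (B1 : @is_dual Y (fun y => pair f ((y, dzero Y), dzero X))).
  { split; [|split].
    - intros y y'. rewrite <- pair_addr. f_equal. cbn [TripleB ProdB badd B fst snd].
      f_equal; [f_equal|]; symmetry; [apply (badd_0 (DualB Y))|apply (badd_0 (DualB X))].
    - intros c y. rewrite <- pair_scalr. f_equal. cbn [TripleB ProdB bscal B fst snd].
      f_equal; [f_equal|]; symmetry; [apply (bscal_0r (DualB Y))|apply (bscal_0r (DualB X))].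
    - exists D. intros y. eapply Rle_trans; [apply HfD|].
      apply Rmult_le_compat_l; [assumption|]. unfold TripleB. rewrite !prodB_norm_le. cbn [fst snd].
      pose proof (bnorm_nonneg Y y).
      repeat split; [lra| |]; (eapply Rle_trans; [right; apply (bnorm_zero (DualB _))|assumption]). }
  assert (B2 : @is_bidual Y (fun g => pair f ((bzero Y, g), dzero X))).
  { split; [|split].
    - intros y y'. rewrite <- pair_addr. f_equal. cbn [TripleB ProdB badd B fst snd].
      f_equal; [f_equal|]; symmetry; [apply badd_0|apply (badd_0 (DualB X))].
    - intros c y. rewrite <- pair_scalr. f_equal. cbn [TripleB ProdB bscal B fst snd].
      f_equal; [f_equal|]; symmetry; [apply bscal_0r|apply (bscal_0r (DualB X))].
    - exists D. intros g m Hm Hg. eapply Rle_trans; [apply HfD|].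
      apply Rmult_le_compat_l; [assumption|]. unfold TripleB. rewrite !prodB_norm_le. cbn [fst snd].
      repeat split; [rewrite bnorm_zero; lra|now apply dnorm_least|].
      eapply Rle_trans; [right; apply (bnorm_zero (DualB _))|assumption]. }
  assert (B3 : @is_bidual X (fun g => pair f ((bzero Y, dzero Y), g))).
  { split; [|split].
    - intros y y'. rewrite <- pair_addr. f_equal. cbn [TripleB ProdB badd B fst snd].
      f_equal; f_equal; symmetry; [apply badd_0|apply (badd_0 (DualB Y))].
    - intros c y. rewrite <- pair_scalr. f_equal. cbn [TripleB ProdB bscal B fst snd].
      f_equal; f_equal; symmetry; [apply bscal_0r|apply (bscal_0r (DualB Y))].
    - exists D. intros g m Hm Hg. eapply Rle_trans; [apply HfD|].
      apply Rmult_le_compat_l; [assumption|]. unfold TripleB. rewrite !prodB_norm_le. cbn [fst snd].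
      repeat split; [rewrite bnorm_zero; lra| |now apply dnorm_least].
      eapply Rle_trans; [right; apply (bnorm_zero (DualB _))|assumption]. }
  exists (exist _ _ B1), (exist _ _ B2), (exist _ _ B3). intros y ys us.
  unfold pair at 2. cbn [proj1_sig]. rewrite <- !pair_addr. f_equal.
  cbn [TripleB ProdB DualB badd B fst snd].
  f_equal; [f_equal|].
  - vec.
  - apply dual_ext. intros x. rewrite !pair_add, !pair_zero. ring.
  - apply dual_ext. intros x. rewrite !pair_add, !pair_zero. ring.
Qed.

Section Core.
Variables (X Y : Banach) (S : MOp X) (T : MOp Y).
Variables (FS : X -> Dual X -> R -> Prop) (FT : Y -> Dual Y -> R -> Prop).
Variables (A : X -> Y) (HA : lin_cont A).
Hypothesis HS : strong_epi S FS.
Hypothesis HT : strong_epi T FT.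
Let As := adjoint X Y A HA.

(** The point [((y, ys), us)] of the product minus the point [((A z, w), As w)] of [E]. The
    coordinate [u], which the projection onto the dual forgets, stays in the source so that
    membership in the effective domain remains a closed condition. *)
Definition residual (q : SourceB X Y) : TripleB X Y :=
  let '((u, us), ((z, w), (y, ys))) := q in
  ((bsub y (A z), @bsub (DualB Y) ys w), @bsub (DualB X) us (As w)).

(** One [n] bounds the norms and both values: the levels are convex, closed, bounded and increasing,
    as [open_mapping] requires, and together exhaust the effective domains. *)
Definition level (n : nat) (q : SourceB X Y) : Prop :=
  bnorm (SourceB X Y) q <= INR n /\
  let '((u, us), ((z, w), (y, ys))) := q in FS u us (INR n) /\ FT y ys (INR n).

Lemma residual_lin_cont : lin_cont residual.
Proof.
  destruct (lin_bound _ _ _ HA) as [K [HK HAK]].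
  destruct (lin_bound _ _ _ (adjoint_lin_cont _ _ _ HA)) as [K' [HK' HAK']].
  pose proof (adjoint_lin_cont _ _ _ HA) as HAs.
  split; [|split].
  - intros [[u us] [[z w] [y ys]]] [[u' us'] [[z' w'] [y' ys']]].
    cbn [SourceB TripleB ProdB badd B fst snd residual]. unfold As.
    rewrite (lin_add _ _ _ HA). rewrite (lin_add _ _ _ HAs w w').
    f_equal; [f_equal|]; vec.
  - intros c [[u us] [[z w] [y ys]]].
    cbn [SourceB TripleB ProdB bscal B fst snd residual]. unfold As.
    rewrite (lin_scal _ _ _ HA). rewrite (lin_scal _ _ _ HAs c w).
    f_equal; [f_equal|]; vec.
  - exists (1 + K + K' + 1). intros [[u us] [[z w] [y ys]]].
    set (m := bnorm (SourceB X Y) _).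
    assert (Hm : m <= m) by lra. unfold m at 1 in Hm. unfold SourceB in Hm.
    repeat rewrite prodB_norm_le in Hm. cbn [fst snd] in Hm.
    destruct Hm as [[H1 H2] [[H3 H4] [H5 H6]]].
    assert (Hm0 : 0 <= m) by apply bnorm_nonneg.
    unfold TripleB, residual. rewrite !prodB_norm_le. cbn [fst snd].
    assert (HKm : 0 <= K * m) by now apply Rmult_le_pos.
    assert (HKm' : 0 <= K' * m) by now apply Rmult_le_pos.
    repeat split; (eapply Rle_trans; [apply bnorm_sub_le|]).
    + pose proof (HAK z). assert (K * bnorm X z <= K * m) by (apply Rmult_le_compat_l; lra). lra.
    + lra.
    + pose proof (HAK' w) as Hw. change (bnorm (DualB X) (As w) <= K' * bnorm (DualB Y) w) in Hw.
      assert (K' * bnorm (DualB Y) w <= K' * m) by (apply Rmult_le_compat_l; lra). lra.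
Qed.

Lemma level_convex n : convex_set (SourceB X Y) (level n).
Proof.
  intros [[u us] [[z w] [y ys]]] [[u' us'] [[z' w'] [y' ys']]] l Hl [Hn [H1 H2]] [Hn' [H1' H2']].
  split.
  - eapply Rle_trans; [apply bnorm_triang|]. rewrite !bnorm_scal_pos by lra.
    apply Rmult_le_compat_l with (r := l) in Hn; [|lra].
    apply Rmult_le_compat_l with (r := 1 - l) in Hn'; [|lra]. lra.
  - replace (INR n) with (l * INR n + (1 - l) * INR n) by ring.
    split; [now apply (epi_convex _ _ HS)|now apply (epi_convex _ _ HT)].
Qed.

Lemma level_closed n : closed_seq (SourceB X Y) (level n).
Proof.
  intros q [[u us] [[z w] [y ys]]] Hq Hlim. split.
  - apply converges_norm_le with q; [assumption|]. apply Hq.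
  - apply converges_pair in Hlim. destruct Hlim as [Hl1 Hl2].
    apply converges_pair in Hl1, Hl2. destruct Hl1 as [Hu Hus], Hl2 as [_ Hl2].
    apply converges_pair in Hl2. destruct Hl2 as [Hy Hys]. cbn [fst snd] in *.
    split.
    + apply (epi_closed _ _ HS) with (3 := Hus) (2 := Hu).
      intros k. specialize (Hq k). destruct (q k) as [[? ?] [[? ?] [? ?]]]. apply Hq.
    + apply (epi_closed _ _ HT) with (3 := Hys) (2 := Hy).
      intros k. specialize (Hq k). destruct (q k) as [[? ?] [[? ?] [? ?]]]. apply Hq.
Qed.

(** [L] will be the direction space of the affine hull of the largest difference set, after the
    given point has been moved to 0. [HLabs] is then the intrinsic-core condition: some positive
    multiple of each direction is a residual. *)
Variable L : TripleB X Y -> Prop.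
Hypothesis HL : subspace _ L.
Hypothesis HLcl : closed_seq _ L.
Hypothesis HLres : forall u us r1 y ys r2 z w,
  FS u us r1 -> FT y ys r2 -> L (residual ((u, us), ((z, w), (y, ys)))).
Hypothesis HLabs : forall v, L v -> exists u us r1 y ys r2 z w l,
  FS u us r1 /\ FT y ys r2 /\ 0 < l /\
  residual ((u, us), ((z, w), (y, ys))) = bscal (TripleB X Y) l v.

(** Serves twice: as the constraint qualification behind [duality], and as the ball that turns an
    intrinsic-core point into a relative interior point. *)
Lemma residual_open : exists n r, 0 < r /\
  forall v, L v -> bnorm (TripleB X Y) v <= r -> exists q, level n q /\ residual q = v.
Proof.
  apply (open_mapping (SourceB X Y) (TripleB X Y) residual L residual_lin_cont HL level HLcl).
  - apply level_convex.
  - apply level_closed.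
  - now intros n q [H _].
  - intros m n [[u us] [[z w] [y ys]]] Hmn [Hb [H1 H2]]. apply le_INR in Hmn.
    split; [lra|split; [eapply (epi_up _ _ HS)|eapply (epi_up _ _ HT)]; eassumption].
  - intros n [[u us] [[z w] [y ys]]] [_ [H1 H2]]. eapply HLres; eassumption.
  - intros v Hv. destruct (HLabs v Hv) as [u [us [r1 [y [ys [r2 [z [w [l [H1 [H2 [Hl Heq]]]]]]]]]]]].
    set (q := ((u, us), ((z, w), (y, ys))) : SourceB X Y).
    destruct (INR_unbounded (Rmax (bnorm _ q) (Rmax r1 r2))) as [n Hn].
    exists n, q, l. split; [|split; assumption].
    pose proof (Rmax_l (bnorm _ q) (Rmax r1 r2)). pose proof (Rmax_r (bnorm _ q) (Rmax r1 r2)).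
    pose proof (Rmax_l r1 r2). pose proof (Rmax_r r1 r2).
    split; [lra|split; [eapply (epi_up _ _ HS)|eapply (epi_up _ _ HT)]; try eassumption; lra].
Qed.

(** Exact Fenchel duality, with dual solution [(bs, bss, ass)]: the perturbation function is bounded
    above near 0 in [L], hence bounded below by a multiple of the norm there. *)
Lemma duality (G : X -> Dual X -> R) :
  (forall x f y g l, 0 <= l <= 1 ->
     G (badd X (bscal X l x) (bscal X (1 - l) y)) (dadd (dscal l f) (dscal (1 - l) g))
       <= l * G x f + (1 - l) * G y g) ->
  (forall K, exists M, forall x f, bnorm X x <= K -> dnorm X f <= K -> G x f <= M) ->
  (forall u z w r1 r2, FS u (As w) r1 -> FT (A z) w r2 -> 0 <= r1 + r2 + G (badd X u z) (As w)) ->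
  exists (bs : Dual Y) (bss : Bidual Y) (ass : Bidual X),
    forall u us r1 y ys r2 s w, FS u us r1 -> FT y ys r2 ->
      pair bs y - pair bs (A s) + pair bs (A u) + (bipair bss ys - bipair bss w)
        + (bipair ass us - bipair ass (As w)) <= r1 + r2 + G s (As w).
Proof.
  intros HGc HGb Hnn.
  pose proof (adjoint_lin_cont _ _ _ HA) as HAs.
  (* The perturbation function of the problem, as a relation: the constraint that the residual is 0
     is relaxed to the residual being [v]. *)
  set (F := fun (v : TripleB X Y) r => exists u us z w y ys r1 r2,
     FS u us r1 /\ FT y ys r2 /\ residual ((u, us), ((z, w), (y, ys))) = v /\
     r1 + r2 + G (badd X u z) (As w) <= r).
  assert (HFc : convex_rel _ F).
  { intros v r v' r' l Hl [u [us [z [w [y [ys [r1 [r2 [H1 [H2 [<- H3]]]]]]]]]]]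
      [u' [us' [z' [w' [y' [ys' [r1' [r2' [H1' [H2' [<- H3']]]]]]]]]]].
    eexists _, _, _, _, _, _, _, _.
    split; [apply (epi_convex _ _ HS) with (1 := Hl) (2 := H1) (3 := H1')|].
    split; [apply (epi_convex _ _ HT) with (1 := Hl) (2 := H2) (3 := H2')|].
    split.
    - rewrite <- !(lin_scal _ _ _ residual_lin_cont), <- (lin_add _ _ _ residual_lin_cont).
      reflexivity.
    - pose proof (lin_add _ _ _ HAs (dscal l w) (dscal (1 - l) w')) as E.
      change (As (dadd (dscal l w) (dscal (1 - l) w')) =
        dadd (As (dscal l w)) (As (dscal (1 - l) w'))) in E.
      cbn [SourceB ProdB DualB badd bscal B fst snd].
      rewrite E. clear E.
      pose proof (lin_scal _ _ _ HAs l w) as E1. change (As (dscal l w) = dscal l (As w)) in E1.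
      pose proof (lin_scal _ _ _ HAs (1 - l) w') as E2. change (As (dscal (1 - l) w') = dscal (1 - l) (As w')) in E2.
      rewrite E1, E2.
      replace (badd X (badd X (bscal X l u) (bscal X (1 - l) u')) (badd X (bscal X l z) (bscal X (1 - l) z')))
        with (badd X (bscal X l (badd X u z)) (bscal X (1 - l) (badd X u' z'))) by vec.
      pose proof (HGc (badd X u z) (As w) (badd X u' z') (As w') l Hl).
      apply Rmult_le_compat_l with (r := l) in H3; [|lra].
      apply Rmult_le_compat_l with (r := 1 - l) in H3'; [|lra]. lra. }
  assert (HF0 : forall r, F (bzero _) r -> 0 <= r).
  { intros r [u [us [z [w [y [ys [r1 [r2 [H1 [H2 [Heq H3]]]]]]]]]]].
    eapply Rle_trans; [|apply H3].
    assert (E1 : bsub y (A z) = bzero Y) by exact (f_equal (fun p => fst (fst p)) Heq).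
    assert (E2 : @bsub (DualB Y) ys w = bzero (DualB Y)) by exact (f_equal (fun p => snd (fst p)) Heq).
    assert (E3 : @bsub (DualB X) us (As w) = bzero (DualB X)) by exact (f_equal snd Heq).
    assert (y = A z) by (apply bsub_eq0; rewrite E1; apply bnorm_zero). subst y.
    assert (ys = w) by (apply (bsub_eq0 (DualB Y)); rewrite E2; apply (bnorm_zero (DualB Y))). subst ys.
    assert (us = As w) by (apply (bsub_eq0 (DualB X)); rewrite E3; apply (bnorm_zero (DualB X))). subst us.
    now apply Hnn. }
  destruct residual_open as [n [r [Hr Hopen]]].
  destruct (lin_bound _ _ _ HAs) as [K [HK HAK]].
  pose proof (pos_INR n) as Hn0.
  destruct (HGb (2 * INR n + K * INR n)) as [M0 HM0].
  assert (HKn : 0 <= K * INR n) by now apply Rmult_le_pos.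
  set (M := Rmax 0 (2 * INR n + M0)).
  assert (HM : 0 <= M) by apply Rmax_l.
  assert (HM' : 2 * INR n + M0 <= M) by apply Rmax_r.
  assert (HFM : forall v, L v -> bnorm _ v <= r -> F v M).
  { intros v Hv Hvr. destruct (Hopen v Hv Hvr) as [[[u us] [[z w] [y ys]]] [[Hb [H1 H2]] Heq]].
    exists u, us, z, w, y, ys, (INR n), (INR n). do 3 (split; [assumption|]).
    unfold SourceB in Hb. repeat rewrite prodB_norm_le in Hb. cbn [fst snd] in Hb.
    destruct Hb as [[Hb1 Hb2] [[Hb3 Hb4] [Hb5 Hb6]]].
    assert (G (badd X u z) (As w) <= M0); [|lra]. apply HM0.
    - pose proof (bnorm_triang X u z). lra.
    - specialize (HAK w). change (dnorm X (As w) <= K * bnorm (DualB Y) w) in HAK.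
      assert (K * bnorm (DualB Y) w <= K * INR n) by (apply Rmult_le_compat_l; assumption). lra. }
  assert (HMr : 0 <= M / r) by (apply Rmult_le_pos; [|left; apply Rinv_0_lt_compat]; assumption).
  destruct (linear_minorant (TripleB X Y) F (M / r) HFc) as [f [_ Hf]].
  - exists (bzero _), M. apply HFM; [apply HL|]. rewrite bnorm_zero. lra.
  - assumption.
  - intros v s Hs.
    assert (Hv : L v).
    { destruct Hs as [u [us [z [w [y [ys [r1 [r2 [H1 [H2 [<- H3]]]]]]]]]]].
      eapply HLres; eassumption. }
    destruct (Rle_lt_or_eq_dec 0 _ (bnorm_nonneg _ v)) as [Hm|Hm].
    (* 0 lies on the segment from [v] to [- (r / m) v], where [F] is at most [M]. Convexity and
       [HF0] give [0 <= r s + m M], that is, [s >= - (M / r) m]. *)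
    + set (m := bnorm _ v) in *.
      assert (Hv' : F (bscal _ (- (r / m)) v) M).
      { apply HFM; [now apply HL|]. rewrite bnorm_scal, Rabs_Ropp, Rabs_right.
        - fold m. right. field. lra.
        - left. apply Rdiv_lt_0_compat; assumption. }
      pose proof (HFc _ _ _ _ (r / (r + m)) ltac:(split;
        [left; apply Rdiv_lt_0_compat; lra|
         apply Rmult_le_reg_r with (r + m); [lra|]; unfold Rdiv; rewrite Rmult_assoc, Rinv_l; lra]) Hs Hv') as H.
      replace (badd _ (bscal _ (r / (r + m)) v) (bscal _ (1 - r / (r + m)) (bscal _ (- (r / m)) v)))
        with (bzero (TripleB X Y)) in H by (vec; field; lra).
      apply HF0 in H.
      assert (H' : 0 <= r * s + m * M).
      { replace (r * s + m * M) with ((r + m) * (r / (r + m) * s + (1 - r / (r + m)) * M)) by (field; lra).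
        apply Rmult_le_pos; lra. }
      apply Rmult_le_reg_l with r; [assumption|].
      replace (r * - (M / r * m)) with (- (m * M)) by (field; lra). lra.
    + rewrite <- Hm. symmetry in Hm. apply bnorm_eq0 in Hm. subst v. apply HF0 in Hs. lra.
  - destruct (triple_dual X Y f) as [bs [bss [ass Hf']]].
    exists bs, bss, ass. intros u us r1 y ys r2 s w H1 H2.
    (* Choosing [z = s - u] makes [u + z] a free variable [s], which decouples [G] from the two
       representatives. *)
    assert (HFr : F (residual ((u, us), ((bsub s u, w), (y, ys)))) (r1 + r2 + G s (As w))).
    { exists u, us, (bsub s u), w, y, ys, r1, r2. do 2 (split; [assumption|]). split; [reflexivity|].
      replace (badd X u (bsub s u)) with s by vec. lra. }
    apply Hf in HFr. eapply Rle_trans; [right|apply HFr].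
    unfold residual. rewrite Hf', <- !dsub_bsub, (lin_sub _ _ _ HA), !pair_subr, !bipair_sub. ring.
Qed.

(** * The inf-convolution and its penalised problems *)

Lemma Rabs_le_bounds a b : Rabs a <= b -> - b <= a <= b.
Proof. intros H. pose proof (Rle_abs a). pose proof (Rle_abs (- a)). rewrite Rabs_Ropp in *. lra. Qed.

(** The inclusion sought says that [As w] is a value at [a + z] of the parallel sum of [S] and the
    composition of [T] with [A] and [As]. This is the epigraph of the matching inf-convolution,
    restricted to bounds realised by an actual decomposition, so no infimum has to exist. *)
Definition parallel_epi (x : X) (f : Dual X) (r : R) : Prop :=
  exists u z w r1 r2, As w = f /\ badd X u z = x /\ FS u f r1 /\ FT (A z) w r2 /\ r1 + r2 = r.

Lemma parallel_ge x f r : parallel_epi x f r -> pair f x <= r.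
Proof.
  intros [u [z [w [r1 [r2 [<- [<- [H1 [H2 <-]]]]]]]]].
  apply (epi_ge _ _ HS) in H1. apply (epi_ge _ _ HT) in H2.
  rewrite pair_addr. change (pair (As w) z) with (pair w (A z)). lra.
Qed.

Lemma parallel_convex x f r y g s l : 0 <= l <= 1 ->
  parallel_epi x f r -> parallel_epi y g s ->
  parallel_epi (badd X (bscal X l x) (bscal X (1 - l) y)) (dadd (dscal l f) (dscal (1 - l) g))
    (l * r + (1 - l) * s).
Proof.
  intros Hl [u [z [w [r1 [r2 [<- [<- [H1 [H2 <-]]]]]]]]] [u' [z' [w' [s1 [s2 [<- [<- [H3 [H4 <-]]]]]]]]].
  eexists (badd X (bscal X l u) (bscal X (1 - l) u')), (badd X (bscal X l z) (bscal X (1 - l) z')),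
    (dadd (dscal l w) (dscal (1 - l) w')), _, _.
  split; [now apply dual_ext|].
  split; [vec|].
  split; [apply (epi_convex _ _ HS) with (1 := Hl) (2 := H1) (3 := H3)|].
  split; [|].
  - rewrite (lin_add _ _ _ HA), !(lin_scal _ _ _ HA).
    apply (epi_convex _ _ HT) with (1 := Hl) (2 := H2) (3 := H4).
  - ring.
Qed.

(** Added to [h], it gives [(h - c)(x, f) + <f - f0, x - x0>] plus [k] times the quadratic terms,
    minus [d]. For [k = 1] the quadratic terms dominate the cross pairing; for [k = 0] it is affine
    in [(x, f)] separately, up to [d], and is used at the limit point. *)
Definition penalty (k d : R) (x0 : X) (f0 : Dual X) (x : X) (f : Dual X) : R :=
  - pair f0 x - pair f x0 + pair f0 x0
  + k * (/2 * (bnorm X (bsub x x0))^2 + /2 * (dnorm X (dsub f f0))^2) - d.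

Lemma square_convex l a b c : 0 <= l <= 1 -> 0 <= c -> c <= l * a + (1 - l) * b ->
  c^2 <= l * a^2 + (1 - l) * b^2.
Proof.
  intros Hl Hc H. apply Rle_trans with ((l * a + (1 - l) * b)^2).
  - apply pow_incr. lra.
  - assert (0 <= l * (1 - l) * (a - b)^2).
    { apply Rmult_le_pos; [apply Rmult_le_pos; lra|apply pow2_ge_0]. }
    lra.
Qed.

Lemma penalty_convex k d x0 f0 x f y g l : 0 <= k -> 0 <= l <= 1 ->
  penalty k d x0 f0 (badd X (bscal X l x) (bscal X (1 - l) y)) (dadd (dscal l f) (dscal (1 - l) g))
    <= l * penalty k d x0 f0 x f + (1 - l) * penalty k d x0 f0 y g.
Proof.
  intros Hk Hl. unfold penalty.
  assert (H1 : (bnorm X (bsub (badd X (bscal X l x) (bscal X (1 - l) y)) x0))^2 <=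
     l * (bnorm X (bsub x x0))^2 + (1 - l) * (bnorm X (bsub y x0))^2).
  { apply square_convex; [assumption|apply bnorm_nonneg|].
    replace (bsub (badd X (bscal X l x) (bscal X (1 - l) y)) x0) with
      (badd X (bscal X l (bsub x x0)) (bscal X (1 - l) (bsub y x0))) by vec.
    eapply Rle_trans; [apply bnorm_triang|]. rewrite !bnorm_scal_pos; lra. }
  assert (H2 : (dnorm X (dsub (dadd (dscal l f) (dscal (1 - l) g)) f0))^2 <=
     l * (dnorm X (dsub f f0))^2 + (1 - l) * (dnorm X (dsub g f0))^2).
  { apply square_convex; [assumption|apply dnorm_nonneg|].
    replace (dsub (dadd (dscal l f) (dscal (1 - l) g)) f0) with
      (dadd (dscal l (dsub f f0)) (dscal (1 - l) (dsub g f0)))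
      by (apply dual_ext; intros; pairs; ring).
    eapply Rle_trans; [apply dnorm_triang|]. rewrite !dnorm_scal, !Rabs_right; lra. }
  pairs.
  set (a := (bnorm X (bsub (badd X _ _) x0))^2) in *.
  set (b := (dnorm X (dsub (dadd _ _) f0))^2) in *.
  assert (H3 : k * (/2 * a + /2 * b) <= k * (/2 * (l * bnorm X (bsub x x0) ^ 2 +
     (1 - l) * bnorm X (bsub y x0) ^ 2) + /2 * (l * dnorm X (dsub f f0) ^ 2 +
     (1 - l) * dnorm X (dsub g f0) ^ 2))) by (apply Rmult_le_compat_l; lra).
  lra.
Qed.

Lemma penalty_bounded k d x0 f0 : 0 <= k ->
  forall K, exists M, forall x f, bnorm X x <= K -> dnorm X f <= K -> penalty k d x0 f0 x f <= M.
Proof.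
  intros Hk K.
  exists (dnorm X f0 * K + K * bnorm X x0 + pair f0 x0
     + k * (/2 * (K + bnorm X x0)^2 + /2 * (K + dnorm X f0)^2) - d).
  intros x f Hx Hf. unfold penalty.
  pose proof (dnorm_bound X f0 x) as Hp1. pose proof (dnorm_bound X f x0) as Hp2.
  pose proof (dnorm_nonneg X f0). pose proof (dnorm_nonneg X f).
  pose proof (bnorm_nonneg X x0). pose proof (bnorm_nonneg X x).
  assert (dnorm X f0 * bnorm X x <= dnorm X f0 * K) by (apply Rmult_le_compat_l; lra).
  assert (dnorm X f * bnorm X x0 <= K * bnorm X x0) by (apply Rmult_le_compat_r; lra).
  pose proof (Rle_abs (- pair f0 x)) as Hp3. rewrite Rabs_Ropp in Hp3.
  pose proof (Rle_abs (- pair f x0)) as Hp4. rewrite Rabs_Ropp in Hp4.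
  assert (Hp5 : (bnorm X (bsub x x0))^2 <= (K + bnorm X x0)^2).
  { apply pow_incr. split; [apply bnorm_nonneg|]. pose proof (bnorm_sub_le X x x0). lra. }
  assert (Hp6 : (dnorm X (dsub f f0))^2 <= (K + dnorm X f0)^2).
  { apply pow_incr. split; [apply dnorm_nonneg|]. pose proof (bnorm_sub_le (DualB X) f f0) as Hp6.
    change (dnorm X (dsub f f0) <= dnorm X f + dnorm X f0) in Hp6. lra. }
  assert (k * (/2 * (bnorm X (bsub x x0))^2 + /2 * (dnorm X (dsub f f0))^2) <=
     k * (/2 * (K + bnorm X x0)^2 + /2 * (K + dnorm X f0)^2)) by (apply Rmult_le_compat_l; lra).
  lra.
Qed.

(** If the infimum were larger than [d], the dual solution tested at [w = bs] would contradict
    [inf_s (<e,s> + |s|^2/2) = -|e|^2/2] for [e = As bs - f0]. *)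
Lemma approximate_solution x0 f0 d : 0 < d ->
  exists x f r, parallel_epi x f r /\ r + penalty 1 0 x0 f0 x f <= d.
Proof.
  intros Hd. apply NNPP. intros Hn.
  destruct (duality (penalty 1 d x0 f0)) as [bs [bss [ass H]]].
  - intros. apply penalty_convex; lra.
  - apply penalty_bounded; lra.
  - intros u z w r1 r2 H1 H2. apply Rnot_lt_le. intros Hlt. apply Hn.
    exists (badd X u z), (As w), (r1 + r2). split.
    + exists u, z, w, r1, r2. repeat split; assumption.
    + unfold penalty in *. lra.
  (* The error budget: [d / 2] here and [d / 8] from each strong representative, less than [d] in
     total. *)
  - destruct (almost_norming X (dsub (As bs) f0) (d / 2)) as [e He]; [lra|].
    destruct (epi_strong _ _ HS (As bs) ass (d / 8)) as [u [us [r1 [H1 Hlt1]]]]; [lra|].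
    destruct (epi_strong _ _ HT bs bss (d / 8)) as [y [ys [r2 [H2 Hlt2]]]]; [lra|].
    specialize (H u us r1 y ys r2 (badd X x0 e) bs H1 H2).
    change (pair (As bs) u) with (pair bs (A u)) in Hlt1.
    rewrite <- (pair_adjoint _ _ _ HA bs (badd X x0 e)) in H. fold As in H.
    unfold penalty in H. replace (bsub (badd X x0 e) x0) with e in H by vec.
    rewrite pair_sub in He. rewrite !pair_addr in H. lra.
Qed.

(** The coupling bound at the midpoint of the old and the new point yields [<f - f0, x - x0> >= -2
    (r - <f, x>) - 2 (r0 - <f0, x0>)]. The cross pairing is thus at least of order [- e^2], so the
    quadratic terms are at most of that order and both distances at most [3 e]. *)
Lemma approximate_solution_near x0 f0 r0 e : 0 < e -> parallel_epi x0 f0 r0 -> r0 <= pair f0 x0 + e^2 ->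
  exists x f r, parallel_epi x f r /\ r <= pair f x + (/2 * e)^2 /\
    bnorm X (bsub x x0) <= 3 * e /\ dnorm X (dsub f f0) <= 3 * e.
Proof.
  intros He H0 Hr0.
  assert (Hd : 0 < (/2 * e)^2) by (apply pow_lt; lra).
  destruct (approximate_solution x0 f0 ((/2 * e)^2) Hd) as [x [f [r [H Hr]]]].
  exists x, f, r. split; [assumption|].
  unfold penalty in Hr.
  pose proof (dnorm_bound X (dsub f f0) (bsub x x0)) as Hb. apply Rabs_le_bounds in Hb.
  rewrite pair_sub, !pair_subr in Hb.
  set (a := bnorm X (bsub x x0)) in *. set (b := dnorm X (dsub f f0)) in *.
  assert (Ha0 : 0 <= a) by apply bnorm_nonneg. assert (Hb0 : 0 <= b) by apply dnorm_nonneg.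
  pose proof (pow2_ge_0 (a - b)) as Hab.
  pose proof (parallel_ge _ _ _ (parallel_convex _ _ _ _ _ _ (/2) ltac:(lra) H H0)) as Hm.
  pairs in Hm.
  assert (HN : a^2 + b^2 <= 9 * e^2).
  { assert (0 <= e^2) by apply pow2_ge_0. lra. }
  split; [lra|].
  split; apply Rsqr_incr_0; unfold Rsqr; try lra;
    pose proof (pow2_ge_0 a); pose proof (pow2_ge_0 b); lra.
Qed.

(** The conclusion says that the conjugate of the inf-convolution at [(fb, xb)] is at most
    [<fb, xb>]; membership of the limit in [parallel_epi] is not claimed. *)
Lemma limit_solution : exists xb fb, forall x f r, parallel_epi x f r ->
  pair f xb + pair fb x - pair fb xb <= r.
Proof.
  set (half := fun n : nat => (/2)^n).
  destruct (approximate_solution (bzero X) (dzero X) 1 ltac:(lra)) as [x1 [f1 [r1 [H1 Hr1]]]].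
  assert (Hr1' : r1 <= pair f1 x1 + (half O)^2).
  { unfold penalty in Hr1. rewrite pair_zero, pair_zero, pair_zeror in Hr1.
    replace (bsub x1 (bzero X)) with x1 in Hr1 by vec.
    replace (dsub f1 (dzero X)) with f1 in Hr1
      by (apply dual_ext; intros; rewrite pair_sub, pair_zero; ring).
    pose proof (dnorm_bound X f1 x1) as Hb. apply Rabs_le_bounds in Hb.
    pose proof (pow2_ge_0 (bnorm X x1 - dnorm X f1)). unfold half; cbn [pow]. lra. }
  (* The state carries its own index because the invariant depends on it, whereas [dependent_choice]
     takes one fixed invariant. *)
  destruct (@dependent_choice (nat * (X * Dual X * R))
    (fun s => let '(n, (x, f, r)) := s in parallel_epi x f r /\ r <= pair f x + (half n)^2)
    (fun _ s s' => let '(n, (x, f, r)) := s in let '(n', (x', f', r')) := s' in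
       n' = Datatypes.S n /\ bnorm X (bsub x' x) <= 3 * half n /\ dnorm X (dsub f' f) <= 3 * half n)
    (O, (x1, f1, r1))) as [s [Hs0 [Hinv Hrel]]].
  - split; assumption.
  - intros _ [n [[x f] r]] [H Hr].
    destruct (approximate_solution_near x f r (half n) (pow_half_pos n) H Hr)
      as [x' [f' [r' [H' [Hr' [Hx Hf]]]]]].
    exists (Datatypes.S n, (x', f', r')). repeat split; assumption.
  - assert (Hn : forall n, fst (s n) = n).
    { induction n as [|n IH]; [now rewrite Hs0|]. specialize (Hrel n).
      destruct (s n) as [m [[x f] r]], (s (Datatypes.S n)) as [m' [[x' f'] r']]. cbn [fst] in *.
      destruct Hrel as [-> _]. now rewrite IH. }
    set (x := fun n => fst (fst (snd (s n)))). set (f := fun n => snd (fst (snd (s n)))).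
    set (r := fun n => snd (snd (s n))).
    assert (Hinv' : forall n, parallel_epi (x n) (f n) (r n) /\ r n <= pair (f n) (x n) + (half n)^2).
    { intros n. specialize (Hinv n). replace (half n) with (half (fst (s n))) by now rewrite Hn.
      unfold x, f, r.
      destruct (s n) as [m [[? ?] ?]]. exact Hinv. }
    assert (Hrel' : forall n, bnorm X (bsub (x (Datatypes.S n)) (x n)) <= 3 * half n /\
       dnorm X (dsub (f (Datatypes.S n)) (f n)) <= 3 * half n).
    { intros n. specialize (Hrel n). replace (half n) with (half (fst (s n))) by now rewrite Hn.
      unfold x, f.
      destruct (s n) as [m [[? ?] ?]], (s (Datatypes.S n)) as [m' [[? ?] ?]]. apply Hrel. }
    destruct (geometric_converges X x 3) as [xb [Hxb _]]; [apply Hrel'|].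
    destruct (geometric_converges (DualB X) f 3) as [fb [Hfb _]]; [apply Hrel'|].
    exists xb, fb. intros y g t Ht.
    (* Coupling bound on the segment from the [n]-th iterate to [(y, g)], at weight [half n],
       divided by [half n]. The iterate's error [(half n)^2] becomes [half n] and vanishes in the
       limit. *)
    assert (Hineq : forall n, (1 - half n) * (pair g (x n) + pair (f n) y - pair (f n) (x n) - half n)
               + half n * pair g y <= t).
    { intros n. destruct (Hinv' n) as [Hp Hrn].
      assert (Hh : 0 < half n) by apply pow_half_pos.
      assert (Hh1 : half n <= 1).
      { unfold half. rewrite <- (pow1 n). apply pow_incr. lra. }
      pose proof (parallel_ge _ _ _ (parallel_convex _ _ _ _ _ _ (half n) ltac:(lra) Ht Hp)) as Hm.
      pairs in Hm.
      apply Rmult_le_compat_l with (r := 1 - half n) in Hrn; [|lra].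
      apply Rmult_le_reg_l with (half n); [assumption|]. lra. }
    assert (Hhalf : Un_cv half 0).
    { intros e He. destruct (pow_half_small (e / 2)) as [N HN]; [lra|]. exists N. intros n Hn'.
      unfold Rdist. rewrite Rminus_0_r, Rabs_right by (left; apply pow_half_pos).
      specialize (HN n Hn'). unfold half. lra. }
    assert (Hc : forall c, Un_cv (fun _ => c) c).
    { intros c e He. exists O. intros. unfold Rdist. rewrite Rminus_diag, Rabs_R0. assumption. }
    pose proof (pair_converges X x (fun _ => g) xb g Hxb (converges_const (DualB X) g)) as C1.
    pose proof (pair_converges X (fun _ => y) f y fb (converges_const X y) Hfb) as C2.
    pose proof (pair_converges X x f xb fb Hxb Hfb) as C3.
    pose proof (CV_plus _ _ _ _ (CV_mult _ _ _ _ (CV_minus _ _ _ _ (Hc 1) Hhalf)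
      (CV_minus _ _ _ _ (CV_minus _ _ _ _ (CV_plus _ _ _ _ C1 C2) C3) Hhalf))
      (CV_mult _ _ _ _ Hhalf (Hc (pair g y)))) as Hcv.
    pose proof (Rle_cv_lim Hineq Hcv (Hc t)) as Hle. lra.
Qed.

(** With [k = 0] the nonnegativity required by [duality] is [limit_solution]. The right-hand side is
    then affine in [s] and in [w], which turns the inequality for the dual solution into
    equations. *)
Lemma inclusion_solvable : maximal_monotone S -> maximal_monotone T ->
  domain_of_gossez_in_X S -> exists a z w, S a (As w) /\ T (A z) w.
Proof.
  intros [_ HmS] [_ HmT] HD.
  destruct limit_solution as [xb [fb Hlim]].
  destruct (duality (penalty 0 0 xb fb)) as [bs [bss [ass H]]].
  - intros. apply penalty_convex; lra.
  - apply penalty_bounded; lra.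
  - intros u z w r1 r2 H1 H2.
    assert (Hp : parallel_epi (badd X u z) (As w) (r1 + r2)).
    { exists u, z, w, r1, r2. repeat split; assumption. }
    apply Hlim in Hp. unfold penalty. lra.
  - unfold penalty in H.
    destruct (epi_strong _ _ HS (As bs) ass 1 ltac:(lra)) as [u0 [us0 [r10 [H10 _]]]].
    destruct (epi_strong _ _ HT bs bss 1 ltac:(lra)) as [y0 [ys0 [r20 [H20 _]]]].
    (* Along [s = t x] both sides of [H] are affine in [t] and the bound holds for every real [t],
       so the slopes agree. Varying [w] in the same way gives [Ebss]. *)
    assert (Efb : fb = As bs).
    { apply dual_ext. intros x. change (pair (As bs) x) with (pair bs (A x)).
      assert (E : pair fb x - pair bs (A x) = 0); [|lra].
      apply (linear_bounded_above _ (r10 + r20 - pair (As (dzero Y)) xb + pair fb xb - pair bs y0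
        - pair bs (A u0) - (bipair bss ys0 - bipair bss (dzero Y))
        - (bipair ass us0 - bipair ass (As (dzero Y))))). intros t.
      specialize (H u0 us0 r10 y0 ys0 r20 (bscal X t x) (dzero Y) H10 H20).
      rewrite (lin_scal _ _ _ HA), !pair_scalr in H. lra. }
    subst fb.
    assert (Ebss : forall w, bipair bss w = pair w (A xb) - bipair ass (As w)).
    { intros w. assert (E : - bipair bss w - bipair ass (As w) + pair w (A xb) = 0); [|lra].
      apply (linear_bounded_above _ (r10 + r20 + pair bs (A xb) - pair bs y0 - pair bs (A u0)
        - bipair bss ys0 - bipair ass us0)). intros t.
      specialize (H u0 us0 r10 y0 ys0 r20 (bzero X) (dscal t w) H10 H20).
      replace (As (dscal t w)) with (dscal t (As w)) in H by (now apply dual_ext).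
      rewrite !bipair_scal, pair_scal in H.
      change (pair (As w) xb) with (pair w (A xb)) in H.
      change (pair (As bs) xb) with (pair bs (A xb)) in H.
      rewrite (lin_zero _ _ _ HA), !pair_zeror in H. lra. }
    assert (Hmain : forall u us r1 y ys r2, FS u us r1 -> FT y ys r2 ->
      pair bs y + bipair bss ys + bipair ass us + pair bs (A u) <= r1 + r2 + pair bs (A xb)).
    { intros u us r1 y ys r2 H1 H2.
      specialize (H u us r1 y ys r2 (bzero X) (dzero Y) H1 H2).
      replace (As (dzero Y)) with (dzero X) in H by (now apply dual_ext).
      rewrite (lin_zero _ _ _ HA), !pair_zeror, !bipair_zero, pair_zero in H.
      change (pair (As bs) xb) with (pair bs (A xb)) in H. lra. }
    (* Strongness of the representative of [T] at [(bs, bss)] eliminates the [T] variables from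
       [Hmain], up to [e]. *)
    assert (HgS : gossez S ass (As bs)).
    { intros v vs Hv. apply (epi_graph _ _ HS) in Hv.
      rewrite bipair_sub, pair_sub. change (pair (As bs) v) with (pair bs (A v)).
      apply le_epsilon. intros e He.
      destruct (epi_strong _ _ HT bs bss e He) as [y [ys [r2 [H2 Hlt]]]].
      specialize (Hmain _ _ _ _ _ _ Hv H2). rewrite Ebss in Hlt. lra. }
    destruct (HD _ _ HgS) as [a Ha].
    assert (HSa : S a (As bs)).
    { apply HmS. intros v vs Hv. specialize (HgS v vs Hv). rewrite Ha in HgS.
      rewrite pair_subr. lra. }
    (* Once [a] represents [ass], [Ebss] reads [bss w = <w, A (xb - a)>]: the element of the bidual
       of [Y] comes from a point of [Y]. Strongness of the representative of [S] now eliminates the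
       [S] variables. *)
    exists a, (bsub xb a), bs. split; [assumption|].
    apply HmT. intros v vs Hv. apply (epi_graph _ _ HT) in Hv.
    apply le_epsilon. intros e He.
    destruct (epi_strong _ _ HS (As bs) ass e He) as [u [us [r1 [H1 Hlt]]]].
    specialize (Hmain _ _ _ _ _ _ H1 Hv). rewrite Ebss in Hmain. rewrite !Ha in *.
    change (pair (As bs) a) with (pair bs (A a)) in Hlt.
    change (pair (As bs) u) with (pair bs (A u)) in Hlt.
    change (pair (As vs) a) with (pair vs (A a)) in Hmain.
    rewrite (lin_sub _ _ _ HA). rewrite pair_sub, !pair_subr. lra.
Qed.

End Core.

(** * Affine hulls and relative interiors *)

Section AffineHulls.
Variable W : Banach.
Local Notation VW := (VS_B W).
Implicit Types (D : VW -> Prop) (u z : W).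

Lemma lincomb_app (l m : list (R * VW)) : lincomb (l ++ m) = badd W (lincomb l) (lincomb m).
Proof.
  induction l as [|p l IH]; cbn [app lincomb fold_right].
  - fold (lincomb m). cbn [VS_B vzero]. vec.
  - fold (lincomb (l ++ m)). fold (lincomb l). rewrite IH. vec.
Qed.

Lemma sum_coef_app (l m : list (R * VW)) : sum_coef (l ++ m) = sum_coef l + sum_coef m.
Proof.
  induction l as [|p l IH]; cbn [app sum_coef fold_right].
  { fold (sum_coef m). ring. }
  fold (sum_coef (l ++ m)). fold (sum_coef l). rewrite IH. ring.
Qed.

Definition rescale (c : R) (l : list (R * VW)) : list (R * VW) :=
  map (fun p => (c * fst p, snd p)) l.

Lemma lincomb_rescale c l : lincomb (rescale c l) = bscal W c (lincomb l).
Proof.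
  induction l as [|p l IH]; cbn [rescale map lincomb fold_right fst snd].
  - cbn [VS_B vzero]. vec.
  - fold (rescale c l). fold (lincomb (rescale c l)). fold (lincomb l). rewrite IH. vec.
Qed.

Lemma sum_coef_rescale c l : sum_coef (rescale c l) = c * sum_coef l.
Proof.
  induction l as [|p l IH]; cbn [rescale map sum_coef fold_right fst snd]; [ring|].
  fold (rescale c l). fold (sum_coef (rescale c l)). fold (sum_coef l). rewrite IH. ring.
Qed.

Lemma rescale_Forall (P : W -> Prop) c (l : list (R * VW)) :
  Forall (fun p => P (snd p)) l -> Forall (fun p => P (snd p)) (rescale c l).
Proof. intros H. apply Forall_map. exact H. Qed.

Lemma aff_incl D z : D z -> aff D z.
Proof.
  intros H. exists ((1, z) :: nil). split; [now repeat constructor|].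
  cbn [sum_coef lincomb fold_right fst snd]. split; [ring|]. cbn [VS_B vzero vadd vscal]. vec.
Qed.

Lemma aff_translate D z1 z2 z3 c : aff D z1 -> aff D z2 -> aff D z3 ->
  aff D (badd W z1 (bscal W c (bsub z2 z3))).
Proof.
  intros [l1 [F1 [S1 ->]]] [l2 [F2 [S2 ->]]] [l3 [F3 [S3 ->]]].
  exists (l1 ++ rescale c l2 ++ rescale (- c) l3).
  split; [|split].
  - apply Forall_app; split; [assumption|].
    apply Forall_app; split; now apply (rescale_Forall D).
  - rewrite !sum_coef_app, !sum_coef_rescale, S1, S2, S3. ring.
  - rewrite !lincomb_app, !lincomb_rescale. vec.
Qed.

Lemma aff_in_subspace D (N : W -> Prop) m : subspace W N -> (forall d, D d -> N (bsub d m)) ->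
  forall z, aff D z -> N (bsub z m).
Proof.
  intros HN HD z [l [HF [Hs ->]]].
  (* Tails of the list have arbitrary total weight, so the induction compares the combination with
     its weight times [m]. *)
  replace (bsub (lincomb l) m) with (bsub (lincomb l) (bscal W (sum_coef l) m))
    by (rewrite Hs; vec).
  clear Hs. induction HF as [|p l Hp HF IH].
  - cbn [sum_coef lincomb fold_right VS_B vzero].
    replace (bsub (bzero W) (bscal W 0 m)) with (bzero W) by vec. apply HN.
  - cbn [sum_coef lincomb fold_right]. fold (sum_coef l). fold (lincomb l).
    replace (bsub (vadd VW (vscal VW (fst p) (snd p)) (lincomb l)) (bscal W (fst p + sum_coef l) m))
      with (badd W (bscal W (fst p) (bsub (snd p) m)) (bsub (lincomb l) (bscal W (sum_coef l) m))) by vec.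
    apply HN; [apply HN; now apply HD|exact IH].
Qed.

Definition direction D (u w : W) : Prop := aff D (badd W u w).

Lemma direction_subspace D u : aff D u -> subspace W (direction D u).
Proof.
  intros Hu. unfold direction. split; [|split].
  - now replace (badd W u (bzero W)) with u by vec.
  - intros x y Hx Hy. replace (badd W u (badd W x y)) with
      (badd W (badd W u x) (bscal W 1 (bsub (badd W u y) u))) by vec. now apply aff_translate.
  - intros c x Hx. replace (badd W u (bscal W c x)) with
      (badd W u (bscal W c (bsub (badd W u x) u))) by vec. now apply aff_translate.
Qed.

Lemma direction_sub D u z : aff D z -> direction D u (bsub z u).
Proof. intros H. unfold direction. now replace (badd W u (bsub z u)) with z by vec. Qed.

Lemma direction_closed D u : Defs.closed_set (aff D) -> closed_seq W (direction D u).
Proof.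
  intros H x l Hx Hl. unfold direction. apply (H (fun n => badd W u (x n))); [exact Hx|].
  intros eps He. destruct (Hl eps He) as [N HN]. exists N. intros n Hn. specialize (HN n Hn).
  cbn [VS_B vsmall]. replace (@vsub (VS_B W) (badd W u (x n)) (badd W u l)) with (bsub (x n) l) by vec.
  assumption.
Qed.

(** Identifies the hull of differences in [icr] with the direction space: an affine combination
    equal to [u + x] becomes [x] when [u] is subtracted from every point, the weights summing to
    1. *)
Lemma aff_diffset D u x : D u -> (aff (diffset D) x <-> direction D u x).
Proof.
  intros Hu. split.
  - intros Hx. replace x with (bsub x (bzero W)) by vec.
    apply (aff_in_subspace (diffset D)); [now apply direction_subspace, aff_incl| |assumption].
    intros d [a [b [Ha [Hb ->]]]]. unfold direction.
    replace (badd W u (bsub (@vsub VW a b) (bzero W))) with (badd W u (bscal W 1 (bsub a b))) by vec.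
    apply aff_translate; now apply aff_incl.
  - intros [l [HF [Hs Hl]]].
    exists (map (fun p => (fst p, bsub (snd p) u)) l). split; [|split].
    + apply Forall_map. eapply Forall_impl; [|apply HF]. intros p Hp. exists (snd p), u.
      split; [assumption|split; [assumption|]]. cbn [snd]. vec.
    + rewrite <- Hs. clear. induction l as [|p l IH]; [reflexivity|].
      cbn [map sum_coef fold_right fst]. unfold sum_coef in IH. now rewrite IH.
    + replace x with (bsub (lincomb l) (bscal W (sum_coef l) u)) by (rewrite <- Hl, Hs; vec).
      clear. induction l as [|p l IH]; cbn [map sum_coef lincomb fold_right fst snd].
      * cbn [VS_B vzero]. vec.
      * fold (sum_coef l). fold (lincomb l).
        fold (@lincomb VW (map (fun p => (fst p, bsub (snd p) u)) l)). rewrite <- IH. vec.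
Qed.

(** The value [lam = 0] gives membership once some direction exists. For empty [D] the hull of
    differences is empty and [icr D] is the whole space. *)
Lemma icr_mem D u : (exists d, D d) -> icr D u -> D u.
Proof.
  intros [d Hd] H. destruct (H (@vsub VW d d)) as [delta [Hdelta Hl]].
  { apply aff_incl. now exists d, d. }
  specialize (Hl 0 ltac:(lra)). cbn [VS_B vadd vscal] in Hl.
  now replace (badd W u (bscal W 0 (@vsub VW d d))) with u in Hl by vec.
Qed.

Lemma ri_ic D u : ri D u -> ic D u.
Proof.
  intros [Hcl [Hu [delta [Hd Hball]]]]. split; [assumption|].
  intros x Hx. apply (aff_diffset D u x Hu) in Hx.
  pose proof (bnorm_nonneg W x).
  assert (Hd' : 0 < delta / (bnorm W x + 1)) by (apply Rdiv_lt_0_compat; lra).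
  exists (delta / (bnorm W x + 1)). split; [assumption|].
  intros lam Hlam. apply Hball.
  - apply (direction_subspace D u); [now apply aff_incl|assumption].
  - cbn [VS_B vsmall vadd vscal].
    replace (@vsub (VS_B W) (badd W u (bscal W lam x)) u) with (bscal W lam x) by vec.
    rewrite bnorm_scal_pos by lra.
    apply Rle_trans with (delta / (bnorm W x + 1) * (bnorm W x + 1)).
    + apply Rmult_le_compat; lra.
    + right. field. lra.
Qed.

(** [ri K3] is relatively open and contained in [K1], so it is contained in the relative interior
    of anything between [K1] and [K3]. *)
Lemma ic_ri_between (K1 D K3 : VW -> Prop) :
  (exists d, K1 d) -> (forall z, K1 z -> D z) -> (forall z, D z -> K3 z) ->
  (forall u, ic K3 u -> K1 u) -> (forall u, ic K3 u -> ri K3 u) ->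
  (Defs.closed_set (aff D) -> forall z, K3 z -> aff D z) ->
  forall u, (ic D u <-> ic K3 u) /\ (ri D u <-> ic K3 u).
Proof.
  intros [k Hk] H1 H3 Hin Hri Haff u.
  assert (Hmono : forall z, aff D z -> aff K3 z).
  { intros z [l [HF Hl]]. exists l. split; [|assumption].
    eapply Forall_impl; [|apply HF]. intros p; apply H3. }
  assert (Hup : ic K3 u -> ri D u).
  { intros Hu. destruct (Hri u Hu) as [Hcl [HuK [delta [Hd Hball]]]].
    assert (Hsub : forall v, aff K3 v -> bnorm W (bsub v u) <= delta / 2 -> K1 v).
    { intros v Hv Hvu. apply Hin. apply ri_ic. split; [assumption|].
      assert (Hnear : forall z, aff K3 z -> bnorm W (bsub z v) <= delta / 2 -> K3 z).
      { intros z Hz Hzv. apply Hball; [assumption|]. cbn [VS_B vsmall].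
        replace (@vsub (VS_B W) z u) with (bsub z u) by vec.
        pose proof (bnorm_sub_triang W z v u). lra. }
      split.
      - apply Hnear; [assumption|]. replace (bsub v v) with (bzero W) by vec.
        rewrite bnorm_zero. lra.
      - exists (delta / 2). split; [lra|]. intros z Hz Hzv. apply Hnear; [assumption|].
        cbn [VS_B vsmall] in Hzv. now replace (bsub z v) with (@vsub (VS_B W) z v) by vec. }
    assert (Hu1 : K1 u) by now apply Hin.
    (* A point [z] is pulled towards [u] by the factor [t] until it enters the ball contained in
       [K1]; extrapolating from there by [/ t] recovers [z] as an affine combination of points of
       [D]. *)
    assert (Heq : forall z, aff K3 z -> aff D z).
    { intros z Hz. pose proof (bnorm_nonneg W (bsub z u)).
      set (t := delta / 2 / (bnorm W (bsub z u) + 1)).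
      assert (Ht : 0 < t) by (unfold t; repeat apply Rdiv_lt_0_compat; lra).
      replace z with (badd W u (bscal W (/ t) (bsub (badd W u (bscal W t (bsub z u))) u)))
        by (vec; field; lra).
      apply aff_translate; try now apply aff_incl, H1.
      apply aff_incl, H1, Hsub.
      - apply aff_translate; try assumption; now apply aff_incl.
      - replace (bsub (badd W u (bscal W t (bsub z u))) u) with (bscal W t (bsub z u)) by vec.
        rewrite bnorm_scal_pos by lra.
        apply Rle_trans with (t * (bnorm W (bsub z u) + 1)); [apply Rmult_le_compat_l; lra|].
        right. unfold t. field. lra. }
    split; [|split; [now apply H1|]].
    - intros z l Hz Hl. apply Heq. apply (Hcl z); [|assumption]. intros n. now apply Hmono.
    - exists (delta / 2). split; [lra|]. intros v Hv Hvu. apply H1, Hsub; [now apply Hmono|].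
      cbn [VS_B vsmall] in Hvu. now replace (bsub v u) with (@vsub (VS_B W) v u) by vec. }
  assert (Hdown : ic D u -> ic K3 u).
  { intros [Hcl Hicr].
    assert (Hu : D u) by (apply icr_mem; [exists k; now apply H1|assumption]).
    assert (Heq : forall z, aff K3 z -> aff D z).
    { intros z Hz. replace z with (badd W u (bsub z u)) by vec.
      apply (aff_in_subspace K3 (direction D u)); [now apply direction_subspace, aff_incl| |assumption].
      intros d Hd. apply direction_sub. now apply Haff. }
    split.
    - intros z l Hz Hl. apply Hmono. apply (Hcl z); [|assumption]. intros n. now apply Heq.
    - intros x Hx. apply (aff_diffset K3 u x (H3 u Hu)) in Hx.
      destruct (Hicr x) as [delta [Hd Hlam]].
      { apply (aff_diffset D u x Hu). now apply Heq. }
      exists delta. split; [assumption|]. intros lam Hl. now apply H3, Hlam. }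
  split; split; auto.
  - intros H. now apply ri_ic, Hup.
  - intros H. now apply Hdown, ri_ic.
Qed.

(** * Convex hulls *)

Lemma co_incl D z : D z -> co D z.
Proof.
  intros H. exists ((1, z) :: nil). split; [|split].
  - repeat constructor; [assumption|simpl; lra].
  - cbn [sum_coef fold_right fst]. ring.
  - cbn [lincomb fold_right fst snd VS_B vzero vadd vscal]. vec.
Qed.

Lemma co_in_convex D (M : W -> Prop) : convex_set W M -> (forall d, D d -> M d) ->
  forall z, co D z -> M z.
Proof.
  intros HM HD z [l [HF [Hs ->]]].
  (* Tails are not convex combinations, so the induction claims that a nonempty tail is its weight
     times a point of [M]; a tail of weight 0 is 0 times any such point. *)
  assert (Hcone : 0 <= sum_coef l /\ (l <> nil -> exists m, M m /\ lincomb l = bscal W (sum_coef l) m)).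
  { clear Hs. induction HF as [|[c d] l [Hp Hc] HF [IH0 IH]].
    - split; [cbn; lra|congruence].
    - cbn [sum_coef lincomb fold_right]. fold (sum_coef l). fold (lincomb l). cbn [fst snd] in *.
      split; [lra|]. intros _.
      destruct l as [|p l].
      + exists d. split; [now apply HD|]. cbn [sum_coef lincomb fold_right VS_B vzero]. vec.
      + destruct IH as [m [Hm Hl]]; [congruence|]. rewrite Hl.
        set (s := sum_coef (p :: l)) in *.
        destruct (Rle_lt_or_eq_dec 0 (c + s) ltac:(lra)) as [Hcs|Hcs].
        * exists (badd W (bscal W (c / (c + s)) d) (bscal W (1 - c / (c + s)) m)). split.
          -- apply HM; [|now apply HD|assumption]. split.
             ++ apply Rmult_le_pos; [assumption|left; now apply Rinv_0_lt_compat].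
             ++ apply Rmult_le_reg_r with (c + s); [assumption|].
                unfold Rdiv. rewrite Rmult_assoc, Rinv_l; lra.
          -- vec.
        * exists d. split; [now apply HD|]. replace c with 0 by lra. replace s with 0 by lra. vec. }
  destruct Hcone as [_ Hcone]. destruct Hcone as [m [Hm ->]].
  - intros ->. cbn in Hs. lra.
  - rewrite Hs. now replace (bscal W 1 m) with m by vec.
Qed.

End AffineHulls.

(** * Linear functionals that are constant on the graph *)

(** Every representative function dominates the Fitzpatrick function: bound [h] by the coupling on
    the segment from the graph point [(u, us)], where they agree, and let its weight [l] tend to 0.
    The number [K = <f - us, x - u>] is the second-order term. *)
Lemma representative_minorant (X : Banach) (S : MOp X) h u us x f r :
  representative S h -> S u us -> h x f = Fin r -> pair us x + pair f u - pair us u <= r.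
Proof.
  intros [Hconv [_ [Hge Hgr]]] Hu Hx.
  set (K := pair f x - (pair us x + pair f u) + pair us u).
  assert (H : forall l, 0 < l <= 1 -> pair us x + pair f u - pair us u + l * K <= r).
  { intros l Hl.
    assert (H : ER_le (h (badd X (bscal X l x) (bscal X (1 - l) u)) (dadd (dscal l f) (dscal (1 - l) us)))
       (l * r + (1 - l) * pair us u)).
    { apply Hconv; [lra|rewrite Hx; simpl; lra|rewrite (Hgr _ _ Hu); simpl; lra]. }
    pose proof (Hge (badd X (bscal X l x) (bscal X (1 - l) u)) (dadd (dscal l f) (dscal (1 - l) us))) as H'.
    destruct (h (badd X (bscal X l x) _) _) as [s|]; [|destruct H]. cbn [ER_le ER_ge] in *. pairs in H'.
    apply Rmult_le_reg_l with l; [lra|]. unfold K. lra. }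
  apply le_epsilon. intros e He.
  set (l := Rmin 1 (e / (Rabs K + 1))). pose proof (Rabs_pos K).
  assert (He' : 0 < e / (Rabs K + 1)) by (apply Rdiv_lt_0_compat; lra).
  assert (Hl : 0 < l) by (apply Rmin_glb_lt; lra).
  assert (l <= 1) by apply Rmin_l. assert (Hl2 : l <= e / (Rabs K + 1)) by apply Rmin_r.
  specialize (H l ltac:(lra)).
  assert (l * (Rabs K + 1) <= e).
  { replace e with (e / (Rabs K + 1) * (Rabs K + 1)) by (field; lra).
    apply Rmult_le_compat_r; lra. }
  pose proof (Rle_abs (- K)) as HK. rewrite Rabs_Ropp in HK.
  apply Rmult_le_compat_l with (r := l) in HK; lra.
Qed.

Lemma ray_bidual_ok (X : Banach) (y : X) (bss : Bidual X) (t : R) :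
  @is_bidual X (fun f => pair f y + t * bipair bss f).
Proof.
  split; [|split].
  - intros. rewrite bipair_add, pair_add. ring.
  - intros. rewrite bipair_scal, pair_scal. ring.
  - destruct (proj2_sig bss) as [_ [_ [C H]]]. exists (bnorm X y + Rabs t * C). intros f M HM Hf.
    eapply Rle_trans; [apply Rabs_triang|]. specialize (H f M HM Hf). specialize (Hf y).
    rewrite Rabs_mult. apply Rmult_le_compat_l with (r := Rabs t) in H; [|apply Rabs_pos]. lra.
Qed.

(** Since [<bss,bs> = 0], the Gossez closure contains the whole line [(y,ys) + t (bss,bs)], and
    [h^*] is at most the coupling there by type (D). *)
Lemma constant_on_dom (X : Banach) (S : MOp X) h (bs : Dual X) (bss : Bidual X) a :
  maximal_monotone S -> gossez_type_D S -> representative S h ->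
  (exists y ys, S y ys) -> bipair bss bs = 0 ->
  (forall y ys, S y ys -> pair bs y + bipair bss ys = a) ->
  forall x f, dom h x f -> pair bs x + bipair bss f = a.
Proof.
  intros [Hm _] HD Hrep [y [ys Hy]] Hbb Ha x f [r Hr].
  assert (E : pair bs x + bipair bss f - a = 0); [|lra].
  apply (linear_bounded_above _ (pair ys y + r - pair ys x - pair f y)). intros t.
  set (phi := exist _ _ (ray_bidual_ok X y bss t) : Bidual X).
  set (ft := dadd ys (dscal t bs)).
  assert (Hphi : forall g, bipair phi g = pair g y + t * bipair bss g) by reflexivity.
  assert (Hg : gossez S phi ft).
  { intros v vs Hv. rewrite Hphi, bipair_sub. unfold ft.
    rewrite bipair_add, bipair_scal, Hbb. pairs.
    pose proof (Hm _ _ _ _ Hy Hv) as Hmv. pairs in Hmv.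
    pose proof (f_equal (Rmult t) (Ha _ _ Hy)). pose proof (f_equal (Rmult t) (Ha _ _ Hv)). lra. }
  (* The Fitzpatrick inequality at the net points, in the limit. Only [<us i, u i>] mixes the two
     convergences; since the [u i] are bounded, norm convergence of [us i] allows [ft] in its place.
     [K] bounds the norms of [u i] and [x] together. *)
  assert (Hlim : pair ft x + bipair phi f - r <= bipair phi ft).
  { destruct (HD _ _ Hg) as [I [le [u [us [[_ [Hrefl [Htr Hup]]] [HS [[M HM] [Hw Hn]]]]]]]].
    apply le_epsilon. intros e He.
    set (K := Rabs M + bnorm X x + 1).
    pose proof (Rabs_pos M). pose proof (bnorm_nonneg X x).
    assert (HK : 0 < K) by (unfold K; lra).
    assert (Hd : 0 < e / 3 / K) by (repeat apply Rdiv_lt_0_compat; lra).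
    destruct (Hw f (e / 3) ltac:(lra)) as [i1 H1].
    destruct (Hw ft (e / 3) ltac:(lra)) as [i2 H2].
    destruct (Hn (e / 3 / K) Hd) as [i3 H3].
    destruct (Hup i1 i2) as [i4 [Hi1 Hi2]]. destruct (Hup i4 i3) as [i [Hi4 Hi3]].
    specialize (H1 i ltac:(eauto)). specialize (H2 i ltac:(eauto)). specialize (H3 i Hi3).
    destruct (HM i) as [HMi _]. pose proof (Rle_abs M).
    pose proof (representative_minorant X S h (u i) (us i) x f r Hrep (HS i) Hr) as Hmin.
    pose proof (H3 x) as H3x. pose proof (H3 (u i)) as H3u.
    apply Rabs_le_bounds in H3x, H3u. apply Rabs_def2 in H1, H2.
    rewrite pair_sub in H3x, H3u.
    assert (e / 3 / K * bnorm X (u i) + e / 3 / K * bnorm X x <= e / 3).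
    { apply Rle_trans with (e / 3 / K * K); [|right; field; lra].
      rewrite <- Rmult_plus_distr_l. apply Rmult_le_compat_l; [lra|unfold K; lra]. }
    lra. }
  rewrite !Hphi in Hlim. unfold ft in Hlim. rewrite bipair_add, bipair_scal, Hbb in Hlim.
  pairs in Hlim. pose proof (f_equal (Rmult t) (Ha _ _ Hy)). lra.
Qed.

(** * The six sets *)

Section Assembly.
Variables (X Y : Banach) (S : MOp X) (T : MOp Y).
Variables (hS : X -> Dual X -> ER) (hT : Y -> Dual Y -> ER) (A : X -> Y).
Hypotheses (HmS : maximal_monotone S) (HDS : gossez_type_D S) (HrS : strong_representative S hS).
Hypotheses (HmT : maximal_monotone T) (HDT : gossez_type_D T) (HrT : strong_representative T hT).
Hypotheses (HA : lin_cont A) (HDX : domain_of_gossez_in_X S).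
Let As := adjoint X Y A HA.
Local Notation VT := (VS_B (TripleB X Y)).
Let K1 : TripleB X Y -> Prop := set_minus (GT_RS S T) (E_set A).
Let K2 : TripleB X Y -> Prop := set_minus (coGT_coRS S T) (E_set A).
Let K3 : TripleB X Y -> Prop := set_minus (domT_prS hS hT) (E_set A).

(** [VS_T X Y] and the structure on [TripleB X Y] share carrier and operations up to conversion, so
    affine hulls and [icr] coincide and only smallness needs a comparison. *)
Lemma vsmall_norm (v : VS_T X Y) r : 0 < r -> (vsmall (VS_T X Y) v r <-> bnorm (TripleB X Y) v <= r).
Proof.
  intros Hr. destruct v as [[y f] g]. unfold TripleB. rewrite !prodB_norm_le.
  cbn [VS_T VS_prod VS_B VS_D vsmall fst snd].
  rewrite !dnorm_le_iff by lra. reflexivity.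
Qed.

Lemma closed_set_norm (C : TripleB X Y -> Prop) :
  Defs.closed_set (W := VS_T X Y) C <-> Defs.closed_set (W := VT) C.
Proof.
  split; intros H z l Hz Hl; apply (H z l Hz); intros eps He; destruct (Hl eps He) as [N HN];
    exists N; intros n Hn; specialize (HN n Hn); apply (vsmall_norm _ eps He); exact HN.
Qed.

Lemma ic_norm (D : TripleB X Y -> Prop) u : ic (W := VS_T X Y) D u <-> ic (W := VT) D u.
Proof.
  split; intros [Hc Hi]; (split; [|exact Hi]); apply closed_set_norm; exact Hc.
Qed.

Lemma ri_norm (D : TripleB X Y -> Prop) u : ri (W := VS_T X Y) D u <-> ri (W := VT) D u.
Proof.
  split; intros [Hc [Hu [delta [Hd H]]]]; (split; [apply closed_set_norm; exact Hc|]);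
    (split; [exact Hu|]); exists delta; (split; [exact Hd|]); intros v Hv Hs;
    apply (H v Hv); apply (vsmall_norm _ delta Hd); exact Hs.
Qed.

Lemma E_set_adjoint z w : E_set A ((A z, w), As w).
Proof. split; [now exists z|reflexivity]. Qed.

Lemma E_set_inv y f g : E_set A ((y, f), g) -> exists z, y = A z /\ g = As f.
Proof.
  intros [[z ->] Hg]. exists z. split; [reflexivity|]. apply dual_ext. exact Hg.
Qed.

Lemma dom_convex (Z : Banach) (R0 : MOp Z) h : strong_representative R0 h ->
  convex_set (ProdB Z (DualB Z)) (fun p => dom h (fst p) (snd p)).
Proof.
  intros [[Hconv _] _] [x f] [y g] l Hl Hx Hy. cbn [fst snd] in *.
  apply dom_ER_le in Hx, Hy. destruct Hx as [r Hr], Hy as [s Hs].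
  apply dom_ER_le. exists (l * r + (1 - l) * s). exact (Hconv _ _ _ _ _ _ l Hl Hr Hs).
Qed.

Lemma graph_in_dom (Z : Banach) (R0 : MOp Z) h x f : strong_representative R0 h -> R0 x f -> dom h x f.
Proof. intros [[_ [_ [_ H]]] _] Hx. exists (pair f x). now apply H. Qed.

(** Every pair is vacuously monotonically related to the empty graph, so maximality would add
    [(0, 0)] to it. *)
Lemma maximal_nonempty (Z : Banach) (R0 : MOp Z) : maximal_monotone R0 -> exists x f, R0 x f.
Proof.
  intros [_ Hmax]. apply NNPP. intros Hn. apply Hn. exists (bzero Z), (dzero Z).
  apply Hmax. intros y g Hy. exfalso. apply Hn. now exists y, g.
Qed.

Lemma K1_nonempty : exists z, K1 z.
Proof.
  destruct (maximal_nonempty _ _ HmS) as [x [f Hx]]. destruct (maximal_nonempty _ _ HmT) as [y [g Hy]].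
  exists (@vsub (VS_T X Y) ((y, g), f) ((A (bzero X), dzero Y), As (dzero Y))).
  exists ((y, g), f), ((A (bzero X), dzero Y), As (dzero Y)).
  split; [split; [assumption|now exists x]|]. split; [apply E_set_adjoint|reflexivity].
Qed.

Lemma K1_K2 z : K1 z -> K2 z.
Proof.
  intros [[[y g] f] [e [[Hy [x Hx]] [He ->]]]]. exists ((y, g), f), e.
  split; [|now split]. split.
  - now apply (co_incl (ProdB Y (DualB Y)) (fun p => T (fst p) (snd p)) (y, g)).
  - apply (co_incl (DualB X) (fun f => exists x, S x f) f). now exists x.
Qed.

Lemma K2_K3 z : K2 z -> K3 z.
Proof.
  intros [[[y g] f] [e [[Hy Hf] [He ->]]]]. exists ((y, g), f), e.
  split; [|now split]. split.
  - apply (co_in_convex (ProdB Y (DualB Y)) (fun p => T (fst p) (snd p)) (fun p => dom hT (fst p) (snd p)))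
      with (z := (y, g)); [now apply (dom_convex Y T)| |exact Hy].
    intros [y' g'] H. exact (graph_in_dom _ _ _ _ _ HrT H).
  - apply (co_in_convex (DualB X) (fun f => exists x, S x f) (fun f => exists x, dom hS x f))
      with (z := f); [| |exact Hf].
    + intros f1 f2 l Hl [x1 H1] [x2 H2]. exists (badd X (bscal X l x1) (bscal X (1 - l) x2)).
      exact (dom_convex X S hS HrS (x1, f1) (x2, f2) l Hl H1 H2).
    + intros f' [x Hx]. exists x. exact (graph_in_dom _ _ _ _ _ HrS Hx).
Qed.

(** Translating [T] by [(y0, f0)] and [S] by [g0] in the dual variable moves [u] to 0. The [X]
    variable of [S] is not translated, as the difference sets record no such coordinate. *)
Lemma ic_K3 (u : TripleB X Y) : ic (W := VT) K3 u -> K1 u /\ ri (W := VT) K3 u.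
Proof.
  intros [Hcl Hicr].
  assert (Hne : exists z, K3 z).
  { destruct K1_nonempty as [z Hz]. exists z. now apply K2_K3, K1_K2. }
  assert (Hu : K3 u) by now apply icr_mem in Hicr.
  destruct u as [[y0 f0] g0].
  set (u := ((y0, f0), g0) : TripleB X Y) in *.
  set (FS := shift_epi hS (bzero X) g0). set (FT := shift_epi hT y0 f0).
  assert (EFS : strong_epi (shift_op S (bzero X) g0) FS) by now apply shift_strong_epi.
  assert (EFT : strong_epi (shift_op T y0 f0) FT) by now apply shift_strong_epi.
  assert (Hres : forall p ps r1 y ys r2 z w, FS p ps r1 -> FT y ys r2 ->
     K3 (badd (TripleB X Y) u (residual X Y A HA ((p, ps), ((z, w), (y, ys)))))).
  { intros p ps r1 y ys r2 z w H1 H2.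
    exists ((badd Y y y0, dadd ys f0), dadd ps g0), ((A z, w), As w).
    split; [split|split; [apply E_set_adjoint|]].
    - apply dom_ER_le. eexists. exact H2.
    - exists (badd X p (bzero X)). apply dom_ER_le. eexists. exact H1.
    - unfold u, residual, vsub. rewrite <- !dsub_bsub.
      cbn [VS_T VS_prod VS_B VS_D vadd vscal TripleB ProdB DualB badd B fst snd].
      f_equal; [f_equal|].
      + vec.
      + apply dual_ext. intros x. pairs. ring.
      + apply dual_ext. intros x. pairs. change (As w) with (adjoint X Y A HA w). ring. }
  pose proof (direction_subspace _ K3 u (aff_incl _ K3 u Hu)) as HL.
  pose proof (direction_closed _ K3 u Hcl) as HLcl.
  assert (HLres : forall p ps r1 y ys r2 z w, FS p ps r1 -> FT y ys r2 ->
     direction _ K3 u (residual X Y A HA ((p, ps), ((z, w), (y, ys))))).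
  { intros. apply aff_incl. eapply Hres; eassumption. }
  assert (HLabs : forall v, direction _ K3 u v -> exists p ps r1 y ys r2 z w l,
    FS p ps r1 /\ FT y ys r2 /\ 0 < l /\
    residual X Y A HA ((p, ps), ((z, w), (y, ys))) = bscal (TripleB X Y) l v).
  { intros v Hv. destruct (Hicr v) as [l [Hl Hlam]]; [now apply (aff_diffset _ K3 u v Hu)|].
    destruct (Hlam l ltac:(lra)) as [[[y1 f1] g1] [[[y2 f2] g2] [[Hy1 [x1 Hx1]] [He Heq]]]].
    apply E_set_inv in He. destruct He as [z [-> ->]].
    apply dom_ER_le in Hy1, Hx1. destruct Hy1 as [r2 Hr2], Hx1 as [r1 Hr1].
    exists x1, (dsub g1 g0), (r1 - pair (dsub g1 g0) (bzero X) - pair g0 x1 - pair g0 (bzero X)).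
    exists (bsub y1 y0), (dsub f1 f0), (r2 - pair (dsub f1 f0) y0 - pair f0 (bsub y1 y0) - pair f0 y0).
    exists z, f2, l. split; [|split; [|split; [assumption|]]].
    - unfold FS, shift_epi. rewrite badd_0.
      replace (dadd (dsub g1 g0) g0) with g1 by (apply dual_ext; intros; pairs; ring).
      eapply ER_le_trans; [exact Hr1|lra].
    - unfold FT, shift_epi. replace (badd Y (bsub y1 y0) y0) with y1 by vec.
      replace (dadd (dsub f1 f0) f0) with f1 by (apply dual_ext; intros; pairs; ring).
      eapply ER_le_trans; [exact Hr2|lra].
    - replace (bscal (TripleB X Y) l v) with
        (bsub (badd (TripleB X Y) u (bscal (TripleB X Y) l v)) u) by vec.
      change (badd (TripleB X Y) u (bscal (TripleB X Y) l v) =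
        @vsub (VS_T X Y) ((y1, f1), g1) ((A z, f2), As f2)) in Heq.
      rewrite Heq. unfold u, residual, vsub. rewrite <- !dsub_bsub. unfold bsub at 1.
      cbn [VS_T VS_prod VS_B VS_D vadd vscal TripleB ProdB DualB badd bopp B fst snd].
      unfold bsub at 2.
      cbn [TripleB ProdB DualB badd bopp B fst snd].
      f_equal; [f_equal|].
      + vec.
      + apply dual_ext. intros x. pairs. ring.
      + apply dual_ext. intros x. pairs. fold As. ring. }
  split.
  - destruct (inclusion_solvable X Y (shift_op S (bzero X) g0) (shift_op T y0 f0) FS FT A HA EFS EFT
      (direction _ K3 u) HL HLcl HLres HLabs) as [a [z [w [Ha Hz]]]].
    + now apply shift_maximal.
    + now apply shift_maximal.
    (* The translation acts on the dual variable only, so the Gossez closure keeps its components in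
       the bidual and the domain assumption carries over. *)
    + intros phi f Hg. apply (HDX phi (dadd f g0)). intros v vs Hv.
      specialize (Hg v (dsub vs g0)).
      replace (dsub f (dsub vs g0)) with (dsub (dadd f g0) vs) in Hg
        by (apply dual_ext; intros; pairs; ring).
      apply Hg. unfold shift_op. rewrite badd_0.
      now replace (dadd (dsub vs g0) g0) with vs by (apply dual_ext; intros; pairs; ring).
    + exists ((badd Y (A z) y0, dadd w f0), dadd (As w) g0), ((A z, w), As w).
      split; [split; [exact Hz|eexists; exact Ha]|]. split; [apply E_set_adjoint|].
      unfold u, vsub. cbn [VS_T VS_prod VS_B VS_D vadd vscal fst snd].
      f_equal; [f_equal|].
      * vec.
      * apply dual_ext. intros x. pairs. ring.
      * apply dual_ext. intros x. pairs. ring.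
  - split; [assumption|split; [assumption|]].
    destruct (residual_open X Y (shift_op S (bzero X) g0) (shift_op T y0 f0) FS FT A HA EFS EFT
      (direction _ K3 u) HL HLcl HLres HLabs) as [n [r [Hr Hopen]]].
    exists r. split; [assumption|]. intros v Hv Hvr.
    destruct (Hopen (bsub v u)) as [[[p ps] [[z w] [y ys]]] [[_ [H1 H2]] Hq]].
    + now apply direction_sub.
    + cbn [VS_B vsmall] in Hvr. now replace (bsub v u) with (@vsub VT v u) by vec.
    + replace v with (badd (TripleB X Y) u (bsub v u)) by vec. rewrite <- Hq.
      eapply Hres; eassumption.
Qed.

(** A continuous functional [(bs, bss, ass)] constant on [K1] vanishes on [E], so
    [<bss,bs> = - <ass, As bs> = 0] and [constant_on_dom] applies to [T] and [S] separately. *)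
Lemma K3_in_aff (D : TripleB X Y -> Prop) : (forall z, K1 z -> D z) ->
  Defs.closed_set (W := VT) (aff (W := VT) D) -> forall z, K3 z -> aff (W := VT) D z.
Proof.
  intros HD Hcl v Hv. apply NNPP. intros Hn.
  destruct K1_nonempty as [k Hk].
  assert (Hak : aff (W := VT) D k) by now apply aff_incl, HD.
  destruct (separate_from_subspace (TripleB X Y) (direction _ D k) (bsub v k)) as [f [Hf0 Hfv]].
  - now apply direction_subspace.
  - now apply direction_closed.
  - unfold direction. now replace (badd (TripleB X Y) k (bsub v k)) with v by vec.
  - apply Hfv.
    destruct (triple_dual X Y f) as [bs [bss [ass Hf]]].
    assert (HfE : forall y g xs z w,
      pair f (@vsub (VS_T X Y) ((y, g), xs) ((A z, w), As w)) =
      pair bs y + bipair bss g + bipair ass xs - (pair bs (A z) + bipair bss w + bipair ass (As w))).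
    { intros. unfold vsub. cbn [VS_T VS_prod VS_B VS_D vadd vscal fst snd].
      rewrite Hf, !bipair_add, !bipair_scal, pair_addr, pair_scalr. ring. }
    assert (Hc : forall y g x xs z w, T y g -> S x xs ->
      pair bs y + bipair bss g + bipair ass xs - (pair bs (A z) + bipair bss w + bipair ass (As w)) = pair f k).
    { intros y g x xs z w Hy Hx. rewrite <- HfE.
      set (q := @vsub (VS_T X Y) ((y, g), xs) ((A z, w), As w)).
      assert (K1 q).
      { exists ((y, g), xs), ((A z, w), As w). split; [split; [assumption|now exists x]|].
        split; [apply E_set_adjoint|reflexivity]. }
      assert (E : pair f (@bsub (TripleB X Y) q k) = 0) by (apply Hf0, direction_sub, aff_incl; auto).
      rewrite pair_subr in E. apply Rminus_diag_uniq. exact E. }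
    destruct (maximal_nonempty _ _ HmS) as [x0 [xs0 Hx0]].
    destruct (maximal_nonempty _ _ HmT) as [y0 [g0 Hy0]].
    assert (Hbs : forall z, pair bs (A z) = 0).
    { intros z. pose proof (Hc _ _ _ _ z (dzero Y) Hy0 Hx0) as E1.
      pose proof (Hc _ _ _ _ (bzero X) (dzero Y) Hy0 Hx0) as E2.
      rewrite (lin_zero _ _ _ HA), pair_zeror in E2. lra. }
    assert (Hbss : forall w, bipair bss w + bipair ass (As w) = 0).
    { intros w. pose proof (Hc _ _ _ _ (bzero X) w Hy0 Hx0) as E1.
      pose proof (Hc _ _ _ _ (bzero X) (dzero Y) Hy0 Hx0) as E2.
      replace (As (dzero Y)) with (dzero X) in E2 by now apply dual_ext.
      rewrite !bipair_zero in E2. lra. }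
    assert (Hbb : bipair bss bs = 0).
    { specialize (Hbss bs). replace (As bs) with (dzero X) in Hbss.
      - rewrite bipair_zero in Hbss. lra.
      - apply dual_ext. intros x. symmetry. apply Hbs. }
    assert (Hc' : forall y g x xs, T y g -> S x xs ->
      pair bs y + bipair bss g + bipair ass xs = pair f k).
    { intros y g x xs Hy Hx. pose proof (Hc _ _ _ _ (bzero X) (dzero Y) Hy Hx) as E.
      rewrite Hbs in E. specialize (Hbss (dzero Y)). lra. }
    destruct Hv as [[[y g] xs] [[[y2 w] g2] [[Hy [x Hx]] [He ->]]]].
    apply E_set_inv in He. destruct He as [z [-> ->]].
    rewrite pair_subr, HfE, Hbs.
    (* Fixing a graph point of the other operator splits the constant between [T] and [S]. For [S]
       the functional is [(0, ass)], since only the range of [S] enters the difference sets. *)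
    pose proof (constant_on_dom Y T hT bs bss (pair f k - bipair ass xs0) HmT HDT (proj1 HrT)
      (maximal_nonempty _ _ HmT) Hbb) as HcT.
    pose proof (constant_on_dom X S hS (dzero X) ass (bipair ass xs0) HmS HDS (proj1 HrS)
      (maximal_nonempty _ _ HmS) (bipair_zero _ ass)) as HcS.
    assert (E1 : pair bs y + bipair bss g = pair f k - bipair ass xs0).
    { apply HcT; [|assumption]. intros y' g' Hy'. specialize (Hc' _ _ _ _ Hy' Hx0). lra. }
    assert (E2 : pair (dzero X) x + bipair ass xs = bipair ass xs0).
    { apply HcS; [|assumption]. intros x' f' Hx'. rewrite pair_zero.
      pose proof (Hc' _ _ _ _ Hy0 Hx'). specialize (Hc' _ _ _ _ Hy0 Hx0). lra. }
    rewrite pair_zero in E2. specialize (Hbss w). lra.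
Qed.

Lemma ic_ri_eq (D : TripleB X Y -> Prop) : (forall z, K1 z -> D z) -> (forall z, D z -> K3 z) ->
  forall u, (ic (W := VS_T X Y) D u <-> ic (W := VS_T X Y) K3 u) /\
            (ri (W := VS_T X Y) D u <-> ic (W := VS_T X Y) K3 u).
Proof.
  intros H1 H3 u. rewrite !ic_norm, ri_norm.
  apply (ic_ri_between _ K1 D K3 K1_nonempty H1 H3).
  - intros v Hv. now apply ic_K3.
  - intros v Hv. now apply ic_K3.
  - now apply K3_in_aff.
Qed.

End Assembly.

Theorem theorem3p6 (X Y : Banach) (S : MOp X) (T : MOp Y)
  (hS : X -> Dual X -> ER) (hT : Y -> Dual Y -> ER) (A : X -> Y) :
  nonzero_space X -> nonzero_space Y ->
  maximal_monotone S -> gossez_type_D S -> strong_representative S hS ->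
  maximal_monotone T -> gossez_type_D T -> strong_representative T hT ->
  lin_cont A ->
  (exists z, domT_prS hS hT z /\ E_set A z) ->
  domain_of_gossez_in_X S ->
  let E := E_set A in
  let K1 := set_minus (GT_RS S T) E in
  let K2 := set_minus (coGT_coRS S T) E in
  let K3 := set_minus (domT_prS hS hT) E in
  set_eq (ic K1) (ri K1) /\ set_eq (ri K1) (ic K2) /\ set_eq (ic K2) (ri K2) /\
  set_eq (ri K2) (ic K3) /\ set_eq (ic K3) (ri K3).
Proof.
  intros _ _ HmS HDS HrS HmT HDT HrT HA _ HDX E K1 K2 K3.
  pose proof (ic_ri_eq X Y S T hS hT A HmS HDS HrS HmT HDT HrT HA HDX) as H.
  assert (H12 : forall z, K1 z -> K2 z) by (intros z; apply K1_K2).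
  assert (H23 : forall z, K2 z -> K3 z) by (intros z; now apply K2_K3).
  pose proof (H K1 (fun _ h => h) (fun z h => H23 z (H12 z h))) as E1.
  pose proof (H K2 H12 H23) as E2.
  pose proof (H K3 (fun z h => H23 z (H12 z h)) (fun _ h => h)) as E3.
  split; [|split; [|split; [|split]]]; intros z; destruct (E1 z), (E2 z), (E3 z); tauto.
Qed.
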